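(* Let $G$ be a finite, simple, connected graph that contains no subgraph (not necessarily induced) isomorphic to the cycle $C_4$ and no subgraph isomorphic to the cycle $C_5$. Then $G$ is well-dominated if and only if $G$ is well-covered.
   Context: A set $S$ of vertices dominates $G$ if every vertex of $G$ is in $S$ or adjacent to a vertex of $S$; a dominating set is minimal if no proper subset of it is dominating. $G$ is well-dominated if all minimal dominating sets of $G$ have the same cardinality. $G$ is well-covered if all maximal (with respect to inclusion) independent sets of $G$ have the same cardinality. *)

(* Defs.v *)
From mathcomp Require Import all_boot.
Set Implicit Arguments. Unset Strict Implicit. Unset Printing Implicit Defensive.

Section Graph.
Variables (T : finType) (e : rel T).

Definition simple_graph : Prop := symmetric e /\ irreflexive e.

Definition connected_graph : Prop := forall x y : T, connect e x y.

Definition dominating (S : {set T}) : bool :=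
  [forall v, (v \in S) || [exists u in S, e v u]].

Definition minimal_dominating (S : {set T}) : bool := minset dominating S.

Definition independent (S : {set T}) : bool :=
  [forall u in S, forall v in S, ~~ e u v].

Definition maximal_independent (S : {set T}) : bool := maxset independent S.

Definition well_dominated : Prop :=
  forall S1 S2 : {set T}, minimal_dominating S1 -> minimal_dominating S2 ->
    #|S1| = #|S2|.

Definition well_covered : Prop :=
  forall S1 S2 : {set T}, maximal_independent S1 -> maximal_independent S2 ->
    #|S1| = #|S2|.

Definition has_C4 : Prop :=
  exists a b c d : T, uniq [:: a; b; c; d] /\
    [&& e a b, e b c, e c d & e d a].

Definition has_C5 : Prop :=
  exists a b c d f : T, uniq [:: a; b; c; d; f] /\
    [&& e a b, e b c, e c d, e d f & e f a].

End Graph.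

(* Main.v *)
Require Import Defs.
From mathcomp Require Import all_boot.
Set Implicit Arguments. Unset Strict Implicit. Unset Printing Implicit Defensive.

(** Among the induced subgraphs G[W] of a graph without 4- and 5-cycles, well-coveredness is
    inherited by W minus the closed neighbourhood of an independent set, so one can argue by
    induction on |W|. The outcome (after Finbow, Hartnell and Nowakowski) is that every vertex
    lies in the closed neighbourhood of a simplicial vertex, or in a component that is C7 or a
    certain graph T10 on ten vertices. If all vertices are of the first kind, the simplices
    partition the graph, and a minimal dominating set meets each exactly once: if it had two
    elements in one simplex, each would have a private neighbour outside it, and the simplex of
    that private neighbour would contain no element of the dominating set, leaving its
    simplicial vertex undominated. The two exceptional components are finite checks.

    For the induction, a simplicial vertex s lets one remove N[s]. If there is none, either
    every W minus N[v] is covered by simplices, which forces all degrees to be 2 and the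
    components to be C7, or some W minus N[v] has a component C equal to C7 or T10. In the
    latter case the neighbours of v that have a neighbour outside N[v] and C can be removed by
    an independent set, and a finite analysis of the way v is joined to C leaves only T10. *)

(** * The exceptional graphs C7 and T10 *)

(* T10 on the vertices 0..9; its subgraph on 0..6 is the cycle C7, so that both exceptional
   graphs share one adjacency function. *)
Definition nbrs (i : nat) : seq nat :=
  nth [::] [:: [:: 1; 6; 8]; [:: 0; 2]; [:: 1; 3]; [:: 2; 4; 9]; [:: 3; 5; 9];
               [:: 4; 6]; [:: 5; 0]; [:: 8; 9]; [:: 7; 0]; [:: 7; 3; 4]] i.

Definition adj (i j : nat) : bool := has (eqn j) (nbrs i).

Definition order_exc (n : nat) : bool := n \in [:: 7; 10].
Definition alpha (n : nat) : nat := if n == 7 then 3 else 4.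
Definition verts (n : nat) : seq nat := iota 0 n.

Fixpoint sublists (s : seq nat) : seq (seq nat) :=
  if s is x :: s' then
    let r := sublists s' in r ++ [seq x :: t | t <- r]
  else [:: [::]].

Definition lind (S : seq nat) : bool := all (fun i => all (fun j => ~~ adj i j) S) S.
Definition ldom (S U : seq nat) : bool :=
  all (fun i => (i \in S) || has (adj i) S) U.
Definition meets (S X : seq nat) : bool := has (fun i => i \in X) S.
Definition off (n : nat) (X : seq nat) : seq nat := [seq i <- verts n | i \notin X].

(* [near n p r]: a vertex outside the graph that is adjacent to both p and r would lie on a
   4-cycle or a 5-cycle. Hence the [safe] sets are the possible neighbourhoods. *)
Definition near (n p r : nat) : bool :=
  has (fun s => [&& s != p, s != r, adj p s &
         adj s r || has (fun t => [&& t != p, t != r, adj s t & adj t r]) (verts n)])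
      (verts n).
Definition safe (n : nat) (X : seq nat) : bool :=
  (X != [::]) && all (fun i => all (fun j => (i == j) || ~~ near n i j) X) X.
Definition lsep (X Y : seq nat) : bool :=
  all (fun i => (i \notin Y) && ~~ has (adj i) Y) X.
Definition lfar (n : nat) (X Y : seq nat) : bool :=
  all (fun i => all (fun j => ~~ has (fun k => adj i k && adj k j) (verts n)) Y) X.

(* If a vertex a is attached to the exceptional graph exactly along X, then a together with
   a [short] S is an independent set that is one too small. *)
Definition short n X S :=
  [&& ~~ meets S X, ldom S (off n X) & size S == (alpha n).-1].
(** The attachments of 8 and 9 to the heptagon in T10, up to a rotation by [r]: a vertex and the
    edge opposite to it. *)
Definition t10_pattern (X Y : seq nat) : bool :=
  has (fun r => (X == [:: r]) && perm_eq Y [:: (r + 3) %% 7; (r + 4) %% 7]) (iota 0 7).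

(* X, Y, Z stand for the neighbourhoods in C of neighbours a, b, d of a vertex v with C a
   component of W minus N[v]. If a and b are not adjacent, no maximal independent set S of C
   misses both X and Y, since S + {v} could be exchanged for S + {a, b}. *)
Section Checks.
Variables (n : nat) (safes linds lmis : seq (seq nat)).
Definition hitting X Y := all (fun S => meets S X || meets S Y) lmis.
Definition blocked X Y := has (fun S => meets S Y && short n X S) linds.
Definition blocked2 X Y Z :=
  has (fun S => [&& meets S Y, meets S Z & short n X S]) linds.
(** A fourth neighbour of v would attach to C at a vertex [p] separated from the attachments of the
    other three. *)
Definition noroom X Y Z :=
  all (fun p => ~~ [&& lsep [:: p] X, lsep [:: p] Y & lsep [:: p] Z]) (verts n).

Definition check_short :=
  all (fun X => has (short n X) linds
             && has (fun S => ~~ meets S X && (size S == alpha n)) linds) safes.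
Definition check_nonsimplicial :=
  all (fun i => has (fun j => has (fun k => [&& adj i j, adj i k, j != k & ~~ adj j k])
    (verts n)) (verts n)) (verts n).
Definition check_mindom :=
  all (fun D => (ldom D (verts n) &&
    all (fun d => has (fun w => ((w == d) || adj w d) &&
         all (fun d' => (d' == d) || ((w != d') && ~~ adj w d')) D) (verts n)) D)
     ==> (size D == alpha n)) (sublists (verts n)).
Definition check_conn :=
  all (fun B => ((B != [::]) &&
       all (fun i => all (fun j => j \in B) [seq j <- verts n | adj i j]) B)
     ==> all (fun i => i \in B) (verts n)) (sublists (verts n)).
Definition check_pairs :=
  all (fun X => all (fun Y => (lsep X Y && hitting X Y) ==>
     [|| (n == 7) && (t10_pattern X Y || t10_pattern Y X) |
         blocked X Y && blocked Y X]) safes) safes.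
(** The third neighbour d may be adjacent to a or to b, and then [lfar] is known in place of
    [hitting]; it cannot be adjacent to both, as v, a, d, b would form a 4-cycle. *)
Definition check_triples :=
  all (fun X => all (fun Y => (lsep X Y && hitting X Y) ==>
    all (fun Z => [&& lsep X Z, lsep Y Z, hitting X Z || lfar n X Z,
                      hitting Y Z || lfar n Y Z & hitting X Z || hitting Y Z] ==>
     (n != 7) && noroom X Y Z && (hitting X Z && hitting Y Z ==>
       [|| blocked2 X Y Z, blocked2 Y X Z | blocked2 Z X Y])) safes)
     safes) safes.
End Checks.
Definition safes n := [seq X <- sublists (verts n) | safe n X].
Definition linds n := [seq S <- sublists (verts n) | lind S].
Definition lmis n := [seq S <- linds n | ldom S (verts n)].

Definition checks n :=
  let X := safes n in let I := linds n in let M := lmis n in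
  [&& check_short n X I, check_nonsimplicial n, check_mindom n, check_conn n,
      check_pairs n X I M, check_triples n X I M
      & has (fun S => size S == alpha n) M].

(* [lazy] rather than [vm_compute], which would evaluate both arguments of [&&] and [||]. *)
Lemma checks_exc n : order_exc n -> checks n.
Proof. by rewrite /order_exc !inE => /orP[]/eqP->; lazy. Qed.

Lemma sublists_subseq s S : S \in sublists s -> subseq S s.
Proof.
elim: s S => [|x s IH] S /=; first by rewrite inE => /eqP->.
rewrite mem_cat => /orP[/IH h|/mapP[t /IH h ->]].
  exact: subseq_trans h (subseq_cons _ _).
by rewrite eqxx.
Qed.

Lemma filter_sublists (a : pred nat) s : filter a s \in sublists s.
Proof.
elim: s => [|x s IH] //=; rewrite mem_cat; case: (a x); last by rewrite IH.
by rewrite map_f ?orbT.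
Qed.

Lemma sublist_sub n S : S \in sublists (verts n) -> {subset S <= verts n} /\ uniq S.
Proof.
move=> /sublists_subseq h; split; first exact: mem_subseq.
exact: subseq_uniq h (iota_uniq _ _).
Qed.

(** * Well-covered vertex subsets *)

Section Graph.
Variables (T : finType) (e : rel T).
Hypotheses (e_sym : symmetric e) (e_irr : irreflexive e).

Lemma adj_neq x y : e x y -> x != y.
Proof. by apply: contraTneq => ->; rewrite e_irr. Qed.

Lemma indepP (S : {set T}) :
  reflect {in S &, forall x y, ~~ e x y} (independent e S).
Proof.
apply: (iffP forall_inP) => [h x y xS yS|h x xS]; first exact: (forall_inP (h x xS)).
by apply/forall_inP => y yS; apply: h.
Qed.

Lemma indepW (S R : {set T}) : S \subset R -> independent e R -> independent e S.
Proof.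
by move=> /subsetP SR /indepP h; apply/indepP => x y /SR xR /SR yR; apply: h.
Qed.

Lemma indepU (S R : {set T}) : independent e S -> independent e R ->
  {in S & R, forall x y, ~~ e x y} -> independent e (S :|: R).
Proof.
move=> /indepP hS /indepP hR hSR; apply/indepP => x y.
rewrite !inE => /orP[xS|xR] /orP[yS|yR]; [exact: hS|exact: hSR| |exact: hR].
by rewrite e_sym hSR.
Qed.

Lemma indep1 x : independent e [set x].
Proof. by apply/indepP => y z; rewrite !inE => /eqP-> /eqP->; rewrite e_irr. Qed.

Lemma indepU1 (S : {set T}) x : independent e S -> {in S, forall y, ~~ e x y} ->
  independent e (x |: S).
Proof.
by move=> hS h; apply: indepU => //; [exact: indep1|move=> y z /set1P->; apply: h].
Qed.

Definition mis (W S : {set T}) : Prop :=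
  [/\ S \subset W, independent e S &
      forall w, w \in W -> w \notin S -> exists2 s, s \in S & e w s].

(* G[W] is well-covered with independence number k. *)
Definition wck (W : {set T}) (k : nat) : Prop := forall S, mis W S -> #|S| = k.

Lemma extend_mis (W J : {set T}) : J \subset W -> independent e J ->
  exists2 M, mis W M & J \subset M.
Proof.
move=> JW iJ; pose P (S : {set T}) := (S \subset W) && independent e S.
have PJ : P J by rewrite /P JW iJ.
have [M /maxsetP[/andP[MW iM] maxM] JM] := maxset_exists PJ.
exists M => //; split=> // w wW wM.
case: (boolP [exists s in M, e w s]) => [/exists_inP//|/exists_inPn h].
have PwM : P (w |: M) by rewrite /P subUset sub1set wW MW /= indepU1.
by case/negP: wM; rewrite -(maxM _ PwM (subsetUr _ _)) setU11.
Qed.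

Lemma mis_exists (W : {set T}) : exists M, mis W M.
Proof.
have [||M] := @extend_mis W set0; first exact: sub0set; last by exists M.
by apply/indepP => x y; rewrite inE.
Qed.

Lemma wck_bound (W S : {set T}) k : wck W k -> S \subset W -> independent e S -> #|S| <= k.
Proof.
by move=> wc SW iS; have [M /wc <-] := extend_mis SW iS; apply: subset_leq_card.
Qed.

Definition cnbhs (J : {set T}) : {set T} := [set x | (x \in J) || [exists j in J, e j x]].

Lemma cnbhs1 v x : (x \in cnbhs [set v]) = (x == v) || e v x.
Proof.
rewrite !inE; congr (_ || _); apply/exists_inP/idP => [[j /set1P->//]|h].
by exists v; rewrite ?inE.
Qed.

(** Adding [J] turns any maximal independent set of the remaining vertices into one of [W]. *)
Lemma wck_remove (W J : {set T}) k : wck W k -> J \subset W -> independent e J ->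
  wck (W :\: cnbhs J) (k - #|J|).
Proof.
move=> wc JW iJ S [SW iS domS].
have dJ : [disjoint J & S].
  rewrite disjoint_sym; apply: disjointWl SW _.
  by rewrite -setI_eq0; apply/eqP/setP => x; rewrite !inE; case: (x \in J); rewrite /= ?andbF.
have -> : k = #|J :|: S|.
  apply/esym/wc; split.
  - by rewrite subUset JW; apply: subset_trans SW (subsetDl _ _).
  - apply: indepU => // x y xJ /(subsetP SW); rewrite !inE negb_or => /andP[/andP[_]].
    by move/exists_inPn => /(_ x xJ).
  - move=> w wW; rewrite !inE negb_or => /andP[wJ wS].
    have [wN|wN] := boolP (w \in cnbhs J); last first.
      have [|s sS ws] := domS w _ wS; first by rewrite in_setD wN.
      by exists s; rewrite // inE sS orbT.
    move: wN; rewrite inE (negPf wJ) => /exists_inP[j jJ jw].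
    by exists j; rewrite ?inE ?jJ // e_sym.
by rewrite cardsU disjoint_setI0 // cards0 subn0 addKn.
Qed.

(** A union of components of the subgraph induced on [W]. *)
Definition closed_in (W C : {set T}) : bool :=
  (C \subset W) && [forall x in C, forall y in W, e x y ==> (y \in C)].

Lemma closed_inP (W C : {set T}) :
  reflect (C \subset W /\ forall x y, x \in C -> y \in W -> e x y -> y \in C)
          (closed_in W C).
Proof.
apply: (iffP andP) => -[CW h]; split=> //.
  by move=> x y xC yW; apply/implyP; apply: (forall_inP (forall_inP h x xC)).
by apply/forall_inP => x xC; apply/forall_inP => y yW; apply/implyP; apply: h.
Qed.

Lemma closed_compl (W C : {set T}) : closed_in W C -> closed_in W (W :\: C).
Proof.
move=> /closed_inP[CW h]; apply/closed_inP; split; first exact: subsetDl.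
move=> x y /setDP[xW xC] yW xy; rewrite inE yW andbT.
by apply: contra xC => yC; apply: (h y) => //; rewrite e_sym.
Qed.

Lemma closed_trans (W C D : {set T}) : closed_in W C -> closed_in C D -> closed_in W D.
Proof.
move=> /closed_inP[CW hC] /closed_inP[DC hD]; apply/closed_inP; split.
  exact: subset_trans CW.
by move=> x y xD yW xy; apply: (hD x) => //; apply: (hC x) => //; apply: (subsetP DC).
Qed.

Lemma mis_closedU (W C S R : {set T}) : closed_in W C -> mis C S -> mis (W :\: C) R ->
  mis W (S :|: R) /\ #|S :|: R| = #|S| + #|R|.
Proof.
move=> /closed_inP[CW clC] [SC iS domS] [RD iR domR]; split; last first.
  rewrite cardsU disjoint_setI0 ?cards0 ?subn0 //.
  apply: disjointWl SC _; rewrite disjoint_sym; apply: disjointWl RD _.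
  by rewrite -setI_eq0; apply/eqP/setP => x; rewrite !inE; case: (x \in C); rewrite ?andbF.
split.
- by rewrite subUset (subset_trans SC CW) (subset_trans RD (subsetDl _ _)).
- apply: indepU => // x y /(subsetP SC) xC /(subsetP RD) /setDP[yW yC].
  by apply: contra yC; apply: clC.
- move=> w wW; rewrite inE negb_or => /andP[wS wR].
  have [wC|wC] := boolP (w \in C).
    by have [s sS ws] := domS w wC wS; exists s; rewrite // inE sS.
  have [|s sR ws] := domR w _ wR; first by rewrite inE wC.
  by exists s; rewrite // inE sR orbT.
Qed.

(** Maximal independent sets of [C] and of [W :\: C] combine freely; as the sum of their sizes is
    fixed, neither size can vary. *)
Lemma wck_closed (W C : {set T}) k : wck W k -> closed_in W C ->
  exists k1 k2, [/\ wck C k1, wck (W :\: C) k2 & k = k1 + k2].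
Proof.
move=> wc clC; have [S0 misS0] := mis_exists C; have [R0 misR0] := mis_exists (W :\: C).
have eqk S R : mis C S -> mis (W :\: C) R -> k = #|S| + #|R|.
  by move=> mS mR; have [/wc <-] := mis_closedU clC mS mR.
exists #|S0|, #|R0|; split; last exact: eqk.
- by move=> S mS; apply/(@addIn #|R0|); rewrite -!eqk.
- by move=> R mR; apply/(@addnI #|S0|); rewrite -!eqk.
Qed.

Definition simplicial (W : {set T}) (s : T) : Prop :=
  s \in W /\ forall x y, x \in W -> y \in W -> e s x -> e s y -> x != y -> e x y.

Definition simplicialb (W : {set T}) (s : T) : bool :=
  (s \in W) && [forall x in W, forall y in W, [&& e s x, e s y & x != y] ==> e x y].

Lemma simplicialP (W : {set T}) s : reflect (simplicial W s) (simplicialb W s).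
Proof.
apply: (iffP andP) => -[sW h]; split=> //.
  move=> x y xW yW sx sy nxy; move: (forall_inP (forall_inP h x xW) y yW).
  by rewrite sx sy nxy.
apply/forall_inP => x xW; apply/forall_inP => y yW; apply/implyP => /and3P[sx sy nxy].
exact: h.
Qed.

Lemma not_simplicial (W : {set T}) s : s \in W -> ~~ simplicialb W s ->
  exists x y, [/\ x \in W, y \in W, e s x & [/\ e s y, x != y & ~~ e x y]].
Proof.
move=> sW; rewrite /simplicialb sW => /forall_inPn[x xW] /forall_inPn[y yW].
by rewrite negb_imply => /andP[/and3P[sx sy nxy] xy]; exists x, y.
Qed.

Definition in_simplex (W : {set T}) (x : T) : Prop :=
  exists2 s, simplicial W s & x \in cnbhs [set s].

Lemma simplicial_closed W C s : closed_in W C -> simplicial C s -> simplicial W s.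
Proof.
move=> /closed_inP[CW h] [sC hs]; split; first exact: (subsetP CW).
by move=> x y xW yW sx sy; apply: hs => //; apply: (h s).
Qed.

Lemma simplicial_clique W s x y : simplicial W s -> x \in W -> y \in W ->
  x \in cnbhs [set s] -> y \in cnbhs [set s] -> x != y -> e x y.
Proof.
move=> [sW h] xW yW; rewrite !cnbhs1 => /orP[/eqP->|sx] /orP[/eqP->|sy] nxy //.
- by rewrite eqxx in nxy.
- by rewrite e_sym.
- exact: h.
Qed.

(** If [d] were in both simplices, then in a maximal independent set through [d] one could exchange
    [d] for [m] and [m']: all other neighbours of these two are adjacent to [d]. *)
Lemma simplices_disjoint W k m m' d : wck W k -> simplicial W m -> simplicial W m' -> m != m' ->
  ~~ e m m' -> d \in W -> d \in cnbhs [set m] -> d \notin cnbhs [set m'].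
Proof.
move=> wc sm sm' nmm emm dW dm; apply/negP => dm'.
have [mW _] := sm; have [m'W _] := sm'.
have [||L misL] := @extend_mis W [set d]; [by rewrite sub1set|exact: indep1|].
rewrite sub1set => dL; have [LW /indepP iL _] := misL.
have nd : d != m /\ d != m'.
  split; apply: contraNneq emm => dE.
    by move: dm'; rewrite cnbhs1 dE (negPf nmm) e_sym.
  by move: dm; rewrite cnbhs1 dE eq_sym (negPf nmm).
have far s l : simplicial W s -> d != s -> d \in cnbhs [set s] -> l \in L :\ d -> ~~ e s l.
  move=> ss nds dns /setD1P[nl lL]; apply: contra (iL d l dL lL) => sl.
  apply: (simplicial_clique ss) => //; last by rewrite eq_sym.
    exact: (subsetP LW).
  by rewrite cnbhs1 sl orbT.
have nin s : simplicial W s -> d != s -> d \in cnbhs [set s] -> s \notin L :\ d.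
  move=> ss nds; rewrite cnbhs1 (negPf nds) /= => sd.
  by apply/negP => /setD1P[_ sL]; case/negP: (iL s d sL dL).
have := @wck_bound W (m |: (m' |: L :\ d)) k wc.
rewrite !cardsU1 in_setU1 (negPf nmm) /= (nin _ sm nd.1 dm) (nin _ sm' nd.2 dm').
rewrite -(wc L misL) (cardsD1 d L) dL !add1n ltnn => h; suff: false by [].
apply: h; first by rewrite !subUset !sub1set mW m'W /= (subset_trans (subsetDl _ _) LW).
apply: indepU1 => [|y].
  apply: indepU1 => [|y]; last exact: (far m' y sm' nd.2 dm').
  by apply: indepW (subsetDl _ _) _; have [] := misL.
by rewrite in_setU1 => /orP[/eqP->//|]; exact: (far m y sm nd.1 dm).
Qed.

(** Minimality in terms of private neighbours, a form that restricts to unions of components. *)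
Definition mindom (W D : {set T}) : Prop :=
  [/\ D \subset W, forall w, w \in W -> w \notin D -> exists2 d, d \in D & e w d &
      forall d, d \in D -> exists2 w, w \in W & (w == d) || e w d /\
        forall d', d' \in D -> d' != d -> w != d' /\ ~~ e w d'].

Lemma mis_mindom (W S : {set T}) : mis W S -> mindom W S.
Proof.
move=> [SW /indepP iS domS]; split=> // d dS; exists d; first exact: (subsetP SW).
by split=> [|d' dS' nd]; [rewrite eqxx|split; [rewrite eq_sym|apply: iS]].
Qed.

Lemma mindom_closed (W C D : {set T}) : closed_in W C -> mindom W D -> mindom C (D :&: C).
Proof.
move=> /closed_inP[CW clC] [DW domD privD]; split; first exact: subsetIr.
- move=> w wC; rewrite inE wC andbT => wD.
  have [d dD wd] := domD w (subsetP CW w wC) wD.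
  by exists d; rewrite // inE dD (clC w) // (subsetP DW).
- move=> d /setIP[dD dC]; have [w wW [wd priv]] := privD d dD.
  exists w; first by case/orP: wd => [/eqP->//|wd]; apply: (clC d); rewrite // e_sym.
  by split=> // d' /setIP[dD' _]; apply: priv.
Qed.


(** * Copies of the exceptional graphs *)

Section FourFive.
Hypotheses (noC4 : ~ has_C4 e) (noC5 : ~ has_C5 e).

(** Consecutive vertices differ by irreflexivity, so only the diagonals have to be known to be
    distinct. *)
Lemma C4F a b c d : a != c -> b != d -> e a b -> e b c -> e c d -> e d a -> False.
Proof.
move=> ac bd ab bc cd da; case: noC4; exists a, b, c, d; rewrite ab bc cd da; split=> //.
by rewrite /= !inE !negb_or ac bd (adj_neq ab) (adj_neq bc) (adj_neq cd) eq_sym (adj_neq da).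
Qed.

Lemma C5F a b c d f : a != c -> a != d -> b != d -> b != f -> c != f ->
  e a b -> e b c -> e c d -> e d f -> e f a -> False.
Proof.
move=> ac ad bd bf cf ab bc cd df fa; case: noC5; exists a, b, c, d, f.
rewrite ab bc cd df fa; split=> //.
rewrite /= !inE !negb_or ac ad bd bf cf (adj_neq ab) (adj_neq bc) (adj_neq cd) (adj_neq df).
by rewrite eq_sym (adj_neq fa).
Qed.

Definition iso_exc (n : nat) (C : {set T}) (f : nat -> T) : Prop :=
  [/\ order_exc n, {in verts n &, injective f}, C = [set x in map f (verts n)] &
      {in verts n &, forall i j, e (f i) (f j) = adj i j}].

Section Transport.
Variables (n : nat) (C : {set T}) (f : nat -> T).
Hypothesis isoC : iso_exc n C f.

Let ck : checks n. Proof. by case: isoC => /checks_exc. Qed.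

Lemma f_inj : {in verts n &, injective f}. Proof. by case: isoC. Qed.
Lemma e_adj : {in verts n &, forall i j, e (f i) (f j) = adj i j}.
Proof. by case: isoC. Qed.

Lemma memC i : i \in verts n -> f i \in C.
Proof. by case: isoC => _ _ -> _ hi; rewrite inE map_f. Qed.

Lemma excP x : x \in C -> exists2 i, i \in verts n & x = f i.
Proof. by case: isoC => _ _ -> _; rewrite inE => /mapP. Qed.

(** [img] and [idx] pass between subsets of [C] and lists of indices, on which the finite checks
    run. *)
Definition img (S : seq nat) : {set T} := [set x in map f S].
Definition idx (P : pred T) : seq nat := [seq i <- verts n | P (f i)].

Lemma idx_sub P : idx P \in sublists (verts n). Proof. exact: filter_sublists. Qed.

Lemma mem_img S i : {subset S <= verts n} -> i \in verts n -> (f i \in img S) = (i \in S).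
Proof.
move=> hS hi; rewrite inE; apply/mapP/idP => [[j jS fij]|iS]; last by exists i.
by rewrite (f_inj hi (hS _ jS) fij).
Qed.

Lemma img_sub S : {subset S <= verts n} -> img S \subset C.
Proof. by move=> hS; apply/subsetP => x; rewrite inE => /mapP[i /hS iS ->]; apply: memC. Qed.

Lemma card_img S : {subset S <= verts n} -> uniq S -> #|img S| = size S.
Proof.
move=> hS uS; rewrite cardsE -(size_map f S); apply/card_uniqP.
by rewrite map_inj_in_uniq // => i j /hS hi /hS hj; apply: f_inj.
Qed.

Lemma idxK (B : {set T}) : B \subset C -> img (idx (mem B)) = B.
Proof.
move=> BC; apply/setP => x; rewrite inE; apply/mapP/idP => [[i]|xB].
  by rewrite mem_filter => /andP[iB _] ->.
have [i hi xE] := excP (subsetP BC x xB).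
by exists i; rewrite // mem_filter -xE hi andbT.
Qed.

Lemma card_idx (B : {set T}) : B \subset C -> size (idx (mem B)) = #|B|.
Proof.
move=> BC; have [h u] := sublist_sub (idx_sub (mem B)).
by rewrite -(card_img h u) idxK.
Qed.

Lemma card_exc : #|C| = n.
Proof.
rewrite -(card_idx (subxx C)) /idx (_ : filter _ _ = verts n) ?size_iota //.
by apply/all_filterP/allP => i; apply: memC.
Qed.

Lemma indep_img S : {subset S <= verts n} -> lind S -> independent e (img S).
Proof.
move=> hS /allP iS; apply/indepP => x y; rewrite !inE => /mapP[i hi ->] /mapP[j hj ->].
by rewrite e_adj ?hS //; apply: (allP (iS i hi)).
Qed.

Lemma dom_img S U i : {subset S <= verts n} -> i \in verts n -> ldom S U -> i \in U ->
  f i \notin img S -> exists2 s, s \in img S & e (f i) s.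
Proof.
move=> hS hi /allP h /h; rewrite mem_img // => /orP[->//|/hasP[j jS aij]] _.
by have hj := hS _ jS; exists (f j); rewrite ?e_adj ?mem_img.
Qed.

Lemma mem_idx P i : i \in verts n -> (i \in idx P) = P (f i).
Proof. by move=> hi; rewrite mem_filter hi andbT. Qed.

Lemma mem_safes X : X \in sublists (verts n) -> safe n X -> X \in safes n.
Proof. by move=> h1 h2; rewrite mem_filter h2. Qed.

Lemma safe_att q c : q \notin C -> c \in C -> e q c -> idx (e q) \in safes n.
Proof.
move=> qC cC qc; apply: mem_safes; first exact: idx_sub.
apply/andP; split.
  have [i hi cE] := excP cC; apply/eqP => h.
  by have := mem_idx (e q) hi; rewrite h -cE qc.
have qf k : k \in verts n -> q != f k by move/memC => h; apply: contraNneq qC => ->.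
have inj i j : i \in verts n -> j \in verts n -> i != j -> f i != f j.
  by move=> hi hj; apply: contraNneq => /(f_inj hi hj)->.
apply/allP => i; rewrite mem_filter => /andP[qi hi].
apply/allP => j; rewrite mem_filter => /andP[qj hj].
have [//|nij /=] := eqVneq i j.
apply/hasPn => s hs; apply/negP => /and4P[si sj ais /orP[asj|/hasP[t ht /and4P[ti tj ast atj]]]].
  apply: (@C4F q (f i) (f s) (f j)); rewrite ?e_adj ?qf ?inj //.
  by rewrite e_sym.
apply: (@C5F q (f i) (f s) (f t) (f j)); rewrite ?e_adj ?qf ?inj //; first by rewrite eq_sym.
by rewrite e_sym.
Qed.

(** Provides the two sides of an exchange inside [C] in the presence of an outside vertex [q]: [S]
    cannot be extended once [q] is chosen, yet [S'], equally compatible with [q], is larger by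
    one. *)
Lemma exc_short q c : q \notin C -> c \in C -> e q c ->
  exists S S' : {set T},
  [/\ S \subset C, independent e S, {in S, forall s, ~~ e q s},
      {in C, forall x, ~~ e q x -> x \notin S -> exists2 s, s \in S & e x s} & #|S| = (alpha n).-1]
  /\ [/\ S' \subset C, independent e S', {in S', forall s, ~~ e q s} & #|S'| = alpha n].
Proof.
move=> qC cC qc; case/and5P: ck => /allP/(_ _ (safe_att qC cC qc))/andP[].
have off S : {subset S <= verts n} -> ~~ meets S (idx (e q)) -> {in img S, forall s, ~~ e q s}.
  move=> hS /hasPn h x; rewrite inE => /mapP[i iS ->].
  by rewrite -mem_idx ?hS // h.
case/hasP => S; rewrite mem_filter => /andP[iS /sublist_sub[hS uS]] /and3P[mS dS /eqP sS].
case/hasP => R; rewrite mem_filter => /andP[iR /sublist_sub[hR uR]] /andP[mR /eqP sR] _ _ _ _.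
exists (img S), (img R); split; split.
- exact: img_sub.
- exact: indep_img.
- exact: off.
- move=> x /excP[i hi ->] qi; apply: (dom_img hS hi dS).
  by rewrite mem_filter hi andbT mem_idx.
- by rewrite card_img.
- exact: img_sub.
- exact: indep_img.
- exact: off.
- by rewrite card_img.
Qed.

Lemma exc_nonsimplicial x : x \in C ->
  exists y z, [/\ y \in C, z \in C, e x y & [/\ e x z, y != z & ~~ e y z]].
Proof.
move=> /excP[i hi ->]; case/and3P: ck => _ /allP/(_ i hi)/hasP[j hj /hasP[k hk]] + _.
move=> /and4P[ij ik njk jk].
exists (f j), (f k); rewrite !e_adj // !memC //; split=> //; split=> //.
by apply: contraNneq njk => /(f_inj hj hk)->.
Qed.

Lemma exc_mindom (D : {set T}) : mindom C D -> #|D| = alpha n.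
Proof.
move=> [DC domD privD]; case/and4P: ck => _ _ /allP/(_ _ (idx_sub (mem D)))/implyP h _.
rewrite -(card_idx DC); apply/eqP/h/andP; split.
  apply/allP => i hi; rewrite mem_idx //=; case: (boolP (f i \in D)) => //= iD.
  have [d dD id] := domD _ (memC hi) iD.
  have [j hj dE] := excP (subsetP DC d dD).
  by apply/hasP; exists j; rewrite ?mem_idx //= -?dE // -e_adj -?dE.
apply/allP => d; rewrite mem_filter => /andP[dD hd].
have [w wC [wd privw]] := privD _ dD; have [i hi wE] := excP wC.
apply/hasP; exists i => //; rewrite -e_adj // -wE.
have -> : (i == d) = (w == f d) by rewrite wE; apply/eqP/eqP => [->//|/f_inj->].
rewrite wd /=; apply/allP => d'; rewrite mem_filter => /andP[dD' hd'].
case: eqVneq => //= nd.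
have [|n1 n2] := privw _ dD'; first by apply: contraNneq nd => /f_inj->.
by rewrite -e_adj // -wE n2 andbT; apply: contraNneq n1 => <-; rewrite wE.
Qed.

Lemma exc_conn (B : {set T}) x : x \in B -> x \in C ->
  (forall y z, y \in B -> y \in C -> z \in C -> e y z -> z \in B) -> C \subset B.
Proof.
move=> xB xC clB; case/and5P: ck => _ _ _ /allP/(_ _ (idx_sub (mem B)))/implyP h _.
apply/subsetP => y /excP[j hj ->].
suff /allP/(_ j hj) : all (fun i => i \in idx (mem B)) (verts n) by rewrite mem_idx.
apply: h; apply/andP; split.
  have [i hi xE] := excP xC; apply/eqP => h.
  by have := mem_idx (mem B) hi; rewrite h /= -xE xB.
apply/allP => i; rewrite mem_filter => /andP[iB hi].
apply/allP => k; rewrite mem_filter => /andP[aik hk].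
by rewrite mem_idx //; apply: (clB (f i)); rewrite ?memC ?e_adj.
Qed.

End Transport.

Lemma card_setD_lt (W C : {set T}) : C \subset W -> C != set0 -> #|W :\: C| < #|W|.
Proof.
move=> CW nC; rewrite -(cardsID C W) (setIidPr CW).
by rewrite -[X in X < _]add0n ltn_add2r card_gt0.
Qed.

(** * Minimal dominating sets of structured graphs *)

Definition structured (W : {set T}) (x : T) : Prop :=
  in_simplex W x \/ exists C n f, [/\ closed_in W C, x \in C & iso_exc n C f].

(** [A] need not be decidable, so the case distinction is carried through the enumeration of [W]. *)
Lemma forall_or (A : T -> Prop) (B : Prop) (W : {set T}) :
  (forall x, x \in W -> A x \/ B) -> (forall x, x \in W -> A x) \/ B.
Proof.
move=> h; suff [hA|hB] : (forall x, x \in enum W -> A x) \/ B.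
- by left=> x xW; apply: hA; rewrite mem_enum.
- by right.
have {h} : forall x, x \in enum W -> A x \/ B by move=> x; rewrite mem_enum; apply: h.
elim: (enum W) => [|y s IH] h; first by left.
have [hy|] := h y (mem_head _ _); last by right.
have [x xs|hs|] := IH; [|left|by right]; first by apply: h; rewrite inE xs orbT.
by move=> x; rewrite inE => /predU1P[->|/hs].
Qed.

Lemma structured_cases (W : {set T}) : (forall x, x \in W -> structured W x) ->
  (forall x, x \in W -> in_simplex W x) \/
  exists C n f, [/\ closed_in W C, C != set0 & iso_exc n C f].
Proof.
move=> h; apply: forall_or => x /h[|[C [n [f [clC xC isoC]]]]]; first by left.
by right; exists C, n, f; split=> //; apply/set0Pn; exists x.
Qed.

Lemma simplex_mindom (W D : {set T}) k : wck W k ->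
  (forall x, x \in W -> in_simplex W x) -> mindom W D -> #|D| = k.
Proof.
move=> wc smpl [DW domD privD].
(* A maximal independent set of simplicial vertices has one vertex in each simplex; as the simplices
   cover [W], it is also maximal independent in [W]. *)
have [M [MS iM domM]] := mis_exists [set s | simplicialb W s].
have simpM m : m \in M -> simplicial W m by move/(subsetP MS); rewrite inE => /simplicialP.
have cov x : x \in W -> exists2 m, m \in M & x \in cnbhs [set m].
  move=> xW; have [s ss xs] := smpl x xW.
  have [sM|sM] := boolP (s \in M); first by exists s.
  have [|m mM sm] := domM s _ sM; first by rewrite inE; apply/simplicialP.
  exists m => //; rewrite cnbhs1; case: eqVneq => //= nxm.
  apply: (simplicial_clique ss) => //; last by rewrite eq_sym.
    by have [] := simpM m mM.
  by rewrite cnbhs1 sm orbT.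
have MW : M \subset W by apply/subsetP => m /simpM[].
have misM : mis W M.
  split=> // w wW wM; have [m mM] := cov w wW; rewrite cnbhs1 => /orP[/eqP wm|mw].
    by rewrite wm mM in wM.
  by exists m; rewrite // e_sym.
have disj m m' d : m \in M -> m' \in M -> d \in W -> d \in cnbhs [set m] ->
    d \in cnbhs [set m'] -> m = m'.
  move=> mM mM' dW dm dm'; apply/eqP; apply: contraT => nm.
  have := simplices_disjoint wc (simpM m mM) (simpM m' mM') nm _ dW dm.
  by rewrite dm'; apply; apply: (indepP _ iM).
(* The private neighbour [w] of [d] lies in the simplex of some [m2]. An element of [D] in that
   simplex dominates [w], so it is [d]; hence [m2] is [m], and [d'] dominates [w] as well. *)
have uniqD m d d' : m \in M -> d \in D -> d' \in D -> d \in cnbhs [set m] ->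
    d' \in cnbhs [set m] -> d = d'.
  move=> mM dD dD' dm dm'; apply/eqP; apply: contraT => nd.
  have dW := subsetP DW d dD; have dW' := subsetP DW d' dD'.
  have [w wW [wd priv]] := privD d dD.
  have [m2 mM2 wm2] := cov w wW.
  have [nw1 nw2] : w != d' /\ ~~ e w d' by apply: priv; rewrite // eq_sym.
  have [y yD ym2] : exists2 y, y \in D & y \in cnbhs [set m2].
    have [mD|mD] := boolP (m2 \in D); first by exists m2; rewrite // cnbhs1 eqxx.
    have [y yD ey] := domD m2 (subsetP MW _ mM2) mD.
    by exists y; rewrite // cnbhs1 ey orbT.
  have yd : y = d.
    apply/eqP; apply: contraT => nyd; have [nwy] := priv y yD nyd.
    by rewrite (simplicial_clique (simpM _ mM2)) // (subsetP DW).
  have mE : m2 = m by apply: (disj m2 m d) => //; rewrite -yd.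
  by case/negP: nw2; apply: (simplicial_clique (simpM _ mM)); rewrite // -mE.
(* [g] sends a vertex to the representative of its simplex; by [cov] the default does not occur on
   [W]. *)
pose g d := odflt d [pick m in M | d \in cnbhs [set m]].
have gP d : d \in W -> g d \in M /\ d \in cnbhs [set g d].
  move=> dW; rewrite /g; case: pickP => [m /andP[]//|no].
  by have [m mM dm] := cov d dW; have := no m; rewrite mM dm.
have <- : #|g @: D| = #|D|.
  apply: card_in_imset => d d' dD dD' gE.
  have [gM dg] := gP d (subsetP DW d dD); have [_ dg'] := gP d' (subsetP DW d' dD').
  by apply: (uniqD (g d)) => //; rewrite gE.
rewrite -(wc M misM); congr #|pred_of_set _|; apply/setP => m; apply/imsetP/idP.
  by move=> [d dD ->]; have [] := gP d (subsetP DW d dD).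
move=> mM; have [d dD dm] : exists2 d, d \in D & d \in cnbhs [set m].
  have [mD|mD] := boolP (m \in D); first by exists m; rewrite // cnbhs1 eqxx.
  have [y yD ey] := domD m (subsetP MW _ mM) mD.
  by exists y; rewrite // cnbhs1 ey orbT.
have dW := subsetP DW d dD; have [gM dg] := gP d dW.
by exists d; rewrite // (disj m (g d) d).
Qed.

Lemma structured_mindom (W D : {set T}) k :
  (forall (V : {set T}) j, wck V j -> forall x, x \in V -> structured V x) ->
  wck W k -> mindom W D -> #|D| = k.
Proof.
move=> ST; have [m] := ubnP #|W|; elim: m W D k => // m IH W D k leW wc mD.
have [smpl|[C [n [f [clC nC isoC]]]]] := structured_cases (ST W k wc).
  exact: simplex_mindom mD.
have [k1 [k2 [wc1 wc2 ->]]] := wck_closed wc clC.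
have /closed_inP[CW _] := clC; have [DW _ _] := mD.
rewrite -(cardsID C D); congr (_ + _).
  (* A maximal independent set of [C] is also a minimal dominating set of [C], so both sizes are
     [alpha n]. *)
  rewrite (exc_mindom isoC (mindom_closed clC mD)).
  have [S misS] := mis_exists C.
  by rewrite -(wc1 S misS) (exc_mindom isoC (mis_mindom misS)).
have -> : D :\: C = D :&: (W :\: C) by rewrite setIDA (setIidPl DW).
apply: IH wc2 (mindom_closed (closed_compl clC) mD).
apply: leq_trans (card_setD_lt CW nC) _; by rewrite -ltnS.
Qed.

(** * Removing a simplicial vertex *)

Lemma alphaK n : (alpha n).-1.+1 = alpha n.
Proof. by rewrite /alpha; case: ifP. Qed.

(** Extend [q] together with the short set of [exc_short]; that set dominates every non-neighbour of
    [q] in [C], so the extension gains nothing inside [C]. *)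
Lemma attached_mis (W C : {set T}) n f q c : iso_exc n C f -> C \subset W ->
  q \in W -> q \notin C -> c \in C -> e q c ->
  exists (M R : {set T}), [/\ mis W M, q \in M, #|M :&: C| = (alpha n).-1 &
    [/\ R \subset C, independent e R, {in R, forall r, ~~ e q r} & #|R| = alpha n]].
Proof.
move=> isoC CW qW qC cC qc.
have [S [R [[SC iS qS domS cS] [RC iR qR cR]]]] := exc_short isoC qC cC qc.
have [||M misM] := @extend_mis W (q |: S).
- by rewrite subUset sub1set qW (subset_trans SC CW).
- exact: indepU1.
rewrite subUset sub1set => /andP[qM SM]; exists M, R; split=> //.
rewrite -cS; congr #|pred_of_set _|; apply/eqP; rewrite eqEsubset subsetI SM SC !andbT.
apply/subsetP => x /setIP[xM xC]; apply: contraT => xS.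
have [_ /indepP iM _] := misM.
have [s sS xs] := domS x xC (iM q x qM xM) xS.
by case/negP: (iM x s xM (subsetP SM s sS)).
Qed.

(** Otherwise take [M] through [d] and exchange its part in [K] for the larger [R]. The result stays
    independent, because edges leaving [K] end in [d], whose neighbours [R] avoids. *)
Lemma single_attachment (W : {set T}) k n K f d : wck W k -> iso_exc n K f ->
  K \subset W -> d \in W -> d \notin K ->
  (forall x y, x \in K -> y \in W -> y \notin K -> e x y -> y = d) ->
  forall x, x \in K -> ~~ e d x.
Proof.
move=> wc isoK KW dW dK att x xK; apply/negP => dx.
have [M [R [misM dM cM [RK iR dR cR]]]] := attached_mis isoK KW dW dK xK dx.
have [MW iM _] := misM.
have := @wck_bound W ((M :\: K) :|: R) k wc.
rewrite cardsU disjoint_setI0; last first.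
  rewrite disjoint_sym; apply: disjointWl RK _.
  by rewrite -setI_eq0; apply/eqP/setP => y; rewrite !inE; case: (y \in K); rewrite ?andbF.
rewrite cards0 subn0 cR -(wc M misM) -(cardsID K M) cM -(alphaK n) addnC leq_add2r ltnn.
move=> h; suff: false by []; apply: h.
  by rewrite subUset (subset_trans RK KW) (subset_trans (subsetDl _ _) MW).
apply: indepU => // [|y z /setDP[yM yK] zR]; first exact: indepW (subsetDl _ _) iM.
apply/negP => yz; move: (dR z zR); rewrite -(att z y) ?yz //.
- exact: (subsetP RK).
- exact: (subsetP MW).
- by rewrite e_sym.
Qed.

(** Every contradiction here comes from one count: a maximal independent set of [W] has at most one
    vertex outside [V], as [N[s]] is a clique, while independent subsets of [V] have fewer than [k]
    elements. *)
Lemma simplicial_step (W : {set T}) k s : wck W k -> simplicial W s ->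
  (forall x, x \in W :\: cnbhs [set s] -> structured (W :\: cnbhs [set s]) x) ->
  forall x, x \in W -> structured W x.
Proof.
set V := W :\: _ => wc ss IH x xW; have [sW _] := ss.
have [xs|xs] := boolP (x \in cnbhs [set s]); first by left; exists s.
have wcV : wck V (k - 1).
  by rewrite -[1](cards1 s); apply: wck_remove; rewrite ?sub1set ?indep1.
have VW : V \subset W by apply: subsetDl.
have xV : x \in V by rewrite inE xs.
have clique1 M : mis W M -> #|M :\: V| <= 1.
  move=> [MW /indepP iM _]; rewrite leqNgt; apply/negP => /card_gt1P[y [z [yM zM nyz]]].
  move: yM zM; rewrite !in_setD => /andP[yV yM] /andP[zV zM].
  have yW := subsetP MW _ yM; have zW := subsetP MW _ zM.
  move: yV zV; rewrite yW zW !andbT !negbK => ys zs.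
  by case/negP: (iM y z yM zM); apply: (simplicial_clique ss).
have k0 : 0 < k.
  by have := wck_bound wc _ (indep1 s); rewrite cards1 sub1set => ->.
have bound (R : {set T}) : R \subset V -> independent e R -> #|R| < k.
  by move=> RV iR; have := wck_bound wcV RV iR; rewrite subn1 -ltnS prednK.
have [[p sp xp]|[C [n [f [clC xC isoC]]]]] := IH x xV.
  left; pose P := V :&: cnbhs [set p]; have [pV _] := sp.
  have xP : x \in P by rewrite inE xV.
  have PV : P \subset V by apply: subsetIl.
  have cliqueP y z : y \in P -> z \in P -> y != z -> e y z.
    by move=> /setIP[yV yp] /setIP[zV zp]; apply: (simplicial_clique sp).
  (* A vertex of the clique [P] without neighbours outside [P] is simplicial in [W], and its simplex
     contains [x]. *)
  have [/exists_inP[z zP /forall_inP hz]|] :=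
    boolP [exists z in P, [forall w in W, e z w ==> (w \in P)]].
    have zW := subsetP VW z (subsetP PV z zP).
    exists z; last by rewrite cnbhs1; case: eqVneq => //= nxz; rewrite cliqueP // eq_sym.
    split=> // y1 y2 y1W y2W zy1 zy2; apply: cliqueP.
      exact: (implyP (hz y1 y1W)).
    exact: (implyP (hz y2 y2W)).
  move=> /exists_inPn h; exfalso.
  pose g z := odflt z [pick w in W | e z w && (w \notin P)].
  have gP z : z \in P -> [/\ g z \in W, e z (g z) & g z \notin P].
    move=> zP; rewrite /g; case: pickP => [w /and3P[//]|no].
    case/forall_inPn: (h z zP) => w wW; rewrite negb_imply => hw.
    by have := no w; rewrite wW hw.
  (* The chosen outside neighbours are pairwise nonadjacent by the absence of 4-cycles. Hence some
     [M] contains them and misses [P]; exchanging its part outside [V] for [p] gives at least [k]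
     independent vertices in [V]. *)
  have [||M misM gM] := @extend_mis W (g @: P).
  - by apply/subsetP => _ /imsetP[z /gP[? _ _] ->].
  - apply/indepP => _ _ /imsetP[z zP ->] /imsetP[w wP ->]; apply/negP => gzw.
    have [_ zg gzP] := gP z zP; have [_ wg gwP] := gP w wP.
    have nzw : z != w by apply: contraTneq gzw => ->; rewrite e_irr.
    have gwz : e (g w) (g z) by rewrite e_sym.
    have gz : e (g z) z by rewrite e_sym.
    apply: (C4F _ _ (cliqueP z w zP wP nzw) wg gwz gz).
    + by apply: contraNneq gwP => <-.
    + by apply: contraNneq gzP => <-.
  have [MW iM _] := misM.
  have MP y : y \in M -> y \notin P.
    move=> yM; apply/negP => yP; have [_ yg _] := gP y yP.
    by case/negP: (indepP _ iM y (g y) yM (subsetP gM _ (imset_f g yP))).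
  have pP : p \in P by rewrite inE pV cnbhs1 eqxx.
  have iR : independent e (p |: (M :&: V)).
    apply: indepU1 => [|y /setIP[yM yV]]; first exact: indepW (subsetIl _ _) iM.
    by apply: contra (MP y yM) => py; rewrite inE yV cnbhs1 py orbT.
  have pM : p \notin M by apply: contraL pP; apply: MP.
  have := bound _ _ iR; rewrite subUset sub1set pV subsetIr => /(_ isT).
  rewrite cardsU1 inE (negPf pM) add1n -(wc M misM) -(cardsID V M) -addn2 leq_add2l.
  by move=> lt1; have := leq_trans lt1 (clique1 M misM).
right; exists C, n, f; split=> //; have /closed_inP[CV clCV] := clC.
have CW := subset_trans CV VW.
apply/closed_inP; split=> // c q cC qW cq; apply: contraT => qC; exfalso.
have [|M [R [misM qM cM [RC iR qR cR]]]] := attached_mis isoC CW qW qC cC _.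
  by rewrite e_sym.
have [MW iM _] := misM.
(* Exchanging the part of [M] in [C] for [R] gains one vertex, which makes up for the at most one
   vertex of [M] outside [V]. *)
pose U := (M :&: V) :\: C.
have UV : U \subset V by rewrite /U setDE -setIA setICA subsetIl.
have UM : U \subset M by rewrite /U setDE -setIA subsetIl.
have iU : independent e (U :|: R).
  apply: indepU => // [|y z /setDP[/setIP[yM yV] yC] zR]; first exact: indepW iM.
  by apply: contra yC => yz; apply: (clCV z); rewrite ?(subsetP RC) // e_sym.
have := bound _ _ iU; rewrite subUset UV (subset_trans RC CV) => /(_ isT).
rewrite cardsU disjoint_setI0; last first.
  rewrite disjoint_sym; apply: disjointWl RC _.
  by rewrite -setI_eq0; apply/eqP/setP => y; rewrite !inE; case: (y \in C); rewrite ?andbF.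
rewrite cards0 subn0 cR -(wc M misM) -(cardsID V M) -(cardsID C (M :&: V)) -/U.
rewrite -setIA (setIidPr CV) cM -{1}(alphaK n) addnS [#|U| + _]addnC -addn2 leq_add2l.
by move=> lt1; have := leq_trans lt1 (clique1 M misM).
Qed.

(** * Graphs without simplicial vertices *)

Local Ltac edge := first
  [ assumption | by rewrite e_sym | by rewrite eq_sym | by apply: adj_neq
  | by rewrite eq_sym; apply: adj_neq ].
Local Ltac c4 a b c d := by apply: (@C4F a b c d); edge.
Local Ltac c5 a b c d f := by apply: (@C5F a b c d f); edge.

(** Two nonadjacent neighbours of [a] cannot both be adjacent to [v], since this would be a
    4-cycle. *)
Lemma outer_neighbor (W : {set T}) v a : {in W, forall s, ~~ simplicialb W s} ->
  a \in W -> e v a -> exists w, [/\ w \in W, e a w, w != v & ~~ e v w].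
Proof.
move=> ns aW va; have [x [y [xW yW ax [ay nxy xy]]]] := not_simplicial aW (ns a aW).
have [xv|nxv] := eqVneq x v; first by exists y; rewrite -xv eq_sym.
have [vx|] := boolP (e v x); last by exists x.
have [yv|nyv] := eqVneq y v; first by case/negP: xy; rewrite yv e_sym.
by exists y; split=> //; apply/negP => vy; c4 v x a y.
Qed.

(** * The case where simplices cover every W minus N[v]: heptagons *)

Section AllSimplices.
Variables (W : {set T}) (k : nat).
Hypotheses (wc : wck W k) (ns : {in W, forall s, ~~ simplicialb W s}).
Hypothesis smpl : forall v s, v \in W -> s \in W :\: cnbhs [set v] ->
  in_simplex (W :\: cnbhs [set v]) s.

(** For a neighbour [v] of [a] outside [N[s]], passing to [W] minus [N[v]] deletes only [a] from the
    neighbourhood of [s]. Either [s] is now simplicial, which is the claim, or it lies in the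
    simplex of another vertex [p], which turns out to be simplicial already in [W]. *)
Lemma other_neighbors_clique s a b c : s \in W -> a \in W -> e s a ->
  b \in W -> c \in W -> e s b -> e s c -> b != a -> c != a -> b != c -> e b c.
Proof.
move=> sW aW sa bW cW sb sc nba nca nbc.
have [v [vW av nvs nsv]] := outer_neighbor ns aW sa.
set V := W :\: cnbhs [set v].
have inV x : x \in W -> x != v -> ~~ e v x -> x \in V.
  by move=> xW h1 h2; rewrite in_setD xW cnbhs1 negb_or h1 h2.
have out x : x \in V -> x != v /\ ~~ e v x.
  by rewrite in_setD cnbhs1 negb_or => /andP[/andP[]].
have sV : s \in V by apply: inV; rewrite // 1?eq_sym // e_sym.
have nbV x : x \in W -> e s x -> x != a -> x \in V.
  move=> xW sx nxa; apply: inV => //.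
    by apply: contraNneq nsv => <-.
  by apply/negP => vx; c4 s x v a.
have [p sp ps] := smpl vW sV; have [pV cliqueV] := sp.
have [bV cV] : b \in V /\ c \in V by split; apply: nbV.
move: ps; rewrite cnbhs1; have [sE _|nsp /= ps] := eqVneq s p.
  by rewrite -sE in cliqueV; apply: cliqueV.
have pW : p \in W by case/setDP: pV.
have [npv nvp] := out p pV; have nas : a != s by edge.
(* p is not simplicial in W, so it has a neighbour next to v, and C5 forces that to be a. *)
have key x y : x \in W -> y \in W -> e p x -> e p y -> x != y -> ~~ e x y -> x \notin V -> False.
  move=> xW yW px py nxy xy xV.
  have vx : e v x.
    apply: contraNT xV => nvx; apply: inV => //.
    by apply: contraTneq px => ->; rewrite e_sym.
  have npa : p != a by apply: contraNneq nvp => ->; edge.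
  have nxs : x != s by apply: contraNneq nsv => <-; edge.
  have [xa|nxa] := eqVneq x a; last by c5 v x p s a.
  rewrite {}xa in xW px nxy xy xV vx nxs.
  have yV : y \in V.
    apply: inV => //; first by apply: contraTneq py => ->; rewrite e_sym.
    by apply/negP => vy; c4 v y p a.
  have nys : y != s by apply: contraNneq xy => ->; edge.
  have ys : e y s by apply: cliqueV.
  by c4 a s y p.
have [x [y [xW yW px [py nxy xy]]]] := not_simplicial pW (ns pW).
have [xV|xV] := boolP (x \in V); last by case: (key x y).
have [yV|yV] := boolP (y \in V); last by case: (key y x); rewrite // 1?eq_sym // e_sym.
by case/negP: xy; apply: cliqueV.
Qed.

Lemma two_neighbors s : s \in W -> exists x y,
  [/\ x \in W, y \in W, x != y, ~~ e x y &
      forall z, z \in W -> e s z = (z == x) || (z == y)].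
Proof.
move=> sW; have [x [y [xW yW sx [sy nxy xy]]]] := not_simplicial sW (ns sW).
exists x, y; split=> // z zW; apply/idP/orP => [sz|[]/eqP-> //].
have [|nzx] := eqVneq z x; first by left.
have [|nzy] := eqVneq z y; first by right.
by case/negP: xy; apply: (@other_neighbors_clique s z); rewrite // eq_sym.
Qed.

Lemma other_neighbor s x : s \in W -> x \in W -> e s x -> exists y,
  [/\ y \in W, y != x, ~~ e x y & forall z, z \in W -> e s z = (z == x) || (z == y)].
Proof.
move=> sW xW; have [y [z [yW zW nyz yz N]]] := two_neighbors sW.
rewrite N // => /orP[]/eqP->; first by exists z; rewrite eq_sym.
by exists y; split=> //; [rewrite e_sym|move=> u /N->; rewrite orbC].
Qed.

(** All degrees are 2, so it suffices to follow the path from [v] three steps in both directions and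
    to see that its ends [t1] and [t2] are adjacent. *)
Lemma heptagon_component v : v \in W ->
  exists C n f, [/\ closed_in W C, v \in C & iso_exc n C f].
Proof.
move=> vW; have [a [b [aW bW nab ab Nv]]] := two_neighbors vW.
have va : e v a by rewrite Nv ?eqxx.
have vb : e v b by rewrite Nv ?eqxx ?orbT.
have av_ : e a v by edge.
have [s1 [s1W ns1v vs1 Na]] := other_neighbor aW vW av_.
have bv_ : e b v by edge.
have [s2 [s2W ns2v vs2 Nb]] := other_neighbor bW vW bv_.
have as1 : e a s1 by rewrite Na ?eqxx ?orbT.
have bs2 : e b s2 by rewrite Nb ?eqxx ?orbT.
have s1a_ : e s1 a by edge.
have [t1 [t1W nt1a at1 Ns1]] := other_neighbor s1W aW s1a_.
have s2b_ : e s2 b by edge.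
have [t2 [t2W nt2b bt2 Ns2]] := other_neighbor s2W bW s2b_.
have st1 : e s1 t1 by rewrite Ns1 ?eqxx ?orbT.
have st2 : e s2 t2 by rewrite Ns2 ?eqxx ?orbT.
have ns1b : s1 != b by apply: contraNneq ab => <-.
have ns2a : s2 != a by apply: contraNneq ab => <-; edge.
have ns12 : s1 != s2 by apply/negP => /eqP s12; rewrite -s12 in bs2; c4 v a s1 b.
have s12 : ~~ e s1 s2 by apply/negP => s12; c5 v a s1 s2 b.
have nt1v : t1 != v by apply: contraNneq vs1 => <-; edge.
have nt2v : t2 != v by apply: contraNneq vs2 => <-; edge.
have nt1b : t1 != b.
  by apply: contraTneq st1 => ->; rewrite e_sym Nb // negb_or ns1v.
have nt2a : t2 != a.
  by apply: contraTneq st2 => ->; rewrite e_sym Na // negb_or ns2v eq_sym.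
have nt1s2 : t1 != s2 by apply: contraTneq st1 => ->.
have nt2s1 : t2 != s1 by apply: contraTneq st2 => ->; rewrite e_sym.
(* Otherwise a maximal independent set contains [v], [t1] and [t2], hence none of [s1], [s2], and
   [v] can be exchanged for [a] and [b]. This includes the case that [t1] and [t2] coincide. *)
have t12 : e t1 t2.
  apply: contraT => nt12.
  have [||M misM] := @extend_mis W (v |: (t1 |: [set t2])).
  - by rewrite !subUset !sub1set vW t1W.
  - apply: indepU1 => [|y]; first by apply: indepU1 (indep1 _) _ => y /set1P->.
    by rewrite !inE => /orP[]/eqP->; rewrite Nv // negb_or ?nt1a ?nt2a.
  rewrite !subUset !sub1set => /and3P[vM t1M t2M]; have [MW /indepP iM _] := misM.
  have aM : a \notin M by apply: contraL va => aM; apply: iM.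
  have bM : b \notin M by apply: contraL vb => bM; apply: iM.
  have s1M : s1 \notin M by apply: contraL st1 => s1M; apply: iM.
  have s2M : s2 \notin M by apply: contraL st2 => s2M; apply: iM.
  have := @wck_bound W (a |: (b |: M :\ v)) k wc.
  rewrite -(wc misM) !cardsU1 (cardsD1 v M) vM !inE (negPf nab) (negPf aM) (negPf bM).
  rewrite !andbF !add1n ltnn => h; suff: false by []; apply: h.
    by rewrite !subUset !sub1set aW bW (subset_trans (subsetDl _ _) MW).
  apply: indepU1 => [|y].
    apply: indepU1 => [|y /setD1P[nyv yM]]; first by apply: indepW (subsetDl _ _) _; case: misM.
    by rewrite Nb ?(subsetP MW) // negb_or nyv; apply: contraNneq s2M => <-.
  rewrite in_setU1 => /orP[/eqP->//|/setD1P[nyv yM]].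
  by rewrite Na ?(subsetP MW) // negb_or nyv; apply: contraNneq s1M => <-.
have other s x y y' : (forall z, z \in W -> e s z = (z == x) || (z == y)) ->
    y' \in W -> e s y' -> y' != x -> y = y'.
  by move=> N yW; rewrite N // => /orP[/eqP->|/eqP->//]; rewrite eqxx.
have t1s1_ : e t1 s1 by edge.
have [u1 [_ _ _ Nt1]] := other_neighbor t1W s1W t1s1_.
have t2s2_ : e t2 s2 by edge.
have [u2 [_ _ _ Nt2]] := other_neighbor t2W s2W t2s2_.
have t21 : e t2 t1 by edge.
have u1E := other _ _ _ _ Nt1 t2W t12 nt2s1; rewrite u1E in Nt1.
have u2E := other _ _ _ _ Nt2 t1W t21 nt1s2; rewrite u2E in Nt2.
pose c := [:: v; a; s1; t1; t2; s2; b]; pose f := nth v c.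
have uc : uniq c.
  rewrite /= !inE !negb_or; do ![apply/andP; split]; first [done | edge].
have cW i : i \in verts 7 -> f i \in W.
  by rewrite !inE => /or4P[/eqP->|/eqP->|/eqP->|/or4P[]/eqP->].
(* [i + 6] is the predecessor of [i] modulo 7. *)
have Nf i z : i \in verts 7 -> z \in W ->
    e (f i) z = (z == f ((i + 1) %% 7)) || (z == f ((i + 6) %% 7)).
  rewrite !inE => /or4P[/eqP->|/eqP->|/eqP->|/or4P[]/eqP->] zW; rewrite /f /=.
  - by rewrite Nv.
  - by rewrite Na // orbC.
  - by rewrite Ns1 // orbC.
  - by rewrite Nt1 // orbC.
  - by rewrite Nt2.
  - by rewrite Ns2.
  - by rewrite Nb // orbC.
have lt7 i : (i \in verts 7) = (i < 7) by rewrite mem_iota.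
have f_eq i j : j < 7 -> i < 7 -> (f j == f i) = (j == i) by move=> hj hi; apply: nth_uniq.
exists [set x in map f (verts 7)], 7, f; split=> //.
- apply/closed_inP; split.
    by apply/subsetP => x; rewrite inE => /mapP[i hi ->]; apply: cW.
  move=> x y; rewrite !in_set => /mapP[i hi ->] yW; rewrite Nf //.
  by case/orP => /eqP->; apply: map_f; rewrite lt7 ltn_mod.
- by rewrite in_set; apply/mapP; exists 0.
split=> //; first by move=> i j; rewrite !lt7 => hi hj /eqP; rewrite f_eq // => /eqP.
move=> i j hi hj; rewrite Nf ?cW // !f_eq ?ltn_mod -?lt7 //.
have : all (fun i => all (fun j => ((j == (i + 1) %% 7) || (j == (i + 6) %% 7)) == adj i j)
  (verts 7)) (verts 7) by lazy.
by move/allP/(_ i hi)/allP/(_ j hj)/eqP.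
Qed.

End AllSimplices.

Lemma t10_extension (W C : {set T}) f v a b : iso_exc 7 C f ->
  {in C, forall x, x != v /\ ~~ e v x} -> e v a -> e v b -> a != b -> ~~ e a b ->
  W = v |: (a |: (b |: C)) -> t10_pattern (idx 7 f (e a)) (idx 7 f (e b)) ->
  exists g, iso_exc 10 W g.
Proof.
move=> isoC far va vb nab ab WE /hasP[r hr /andP[/eqP aE bE]].
have lt7 i : (i \in verts 7) = (i < 7) by rewrite mem_iota.
have hm i : (i + r) %% 7 \in verts 7 by rewrite lt7 ltn_mod.
have ea i : e a (f ((i + r) %% 7)) = ((i + r) %% 7 == r).
  by rewrite -(mem_idx f (e a) (hm i)) aE inE.
have eb i : e b (f ((i + r) %% 7)) =
    ((i + r) %% 7 == (r + 3) %% 7) || ((i + r) %% 7 == (r + 4) %% 7).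
  by rewrite -(mem_idx f (e b) (hm i)) (perm_mem bE) !inE.
have : all (fun r => all (fun i => [&&
    all (fun j => adj ((i + r) %% 7) ((j + r) %% 7) == adj i j) (verts 7),
    ((i + r) %% 7 == r) == adj i 8, ~~ adj i 7,
    (((i + r) %% 7 == (r + 3) %% 7) || ((i + r) %% 7 == (r + 4) %% 7)) == adj i 9 &
    all (fun j => ((i + r) %% 7 == (j + r) %% 7) ==> (i == j)) (verts 7)]) (verts 7)) (verts 7)
  by lazy.
move/allP/(_ r hr)/allP => rot.
have adjC i j : i \in verts 10 -> j \in verts 10 -> adj i j = adj j i.
  have : all (fun i => all (fun j => adj i j == adj j i) (verts 10)) (verts 10) by lazy.
  by move=> /allP h hi hj; apply/eqP; apply: (allP (h i hi)).
(* The heptagon is rotated so that [a] is attached at 0; [v], [a], [b] become 7, 8, 9. *)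
pose g i := if i < 7 then f ((i + r) %% 7) else nth v [:: v; a; b] (i - 7).
have split10 i : i \in verts 10 -> i < 7 \/ [\/ i = 7, i = 8 | i = 9].
  rewrite mem_iota /= add0n; case: (ltnP i 7); first by left.
  by move=> h1 h2; right; move: h1 h2; do 10?[case: i => [|i] //]; constructor.
have gC i : i < 7 -> g i \in C by rewrite /g => ->; apply: (memC isoC).
have notC x : e v x -> x \notin C by move=> vx; apply/negP => /far[_]; rewrite vx.
have vC : v \notin C by apply/negP => /far[]; rewrite eqxx.
have aC := notC a va; have bC := notC b vb.
have nva := adj_neq va; have nvb := adj_neq vb.
have adj_lt i j : i < 7 -> j \in verts 10 -> e (g i) (g j) = adj i j.
  move=> i7 hj; have := rot i; rewrite lt7 i7 => /(_ isT)/and5P[/allP h1 /eqP h2 h3 /eqP h4 _].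
  have [j7|jE] := split10 j hj.
    by rewrite /g i7 j7 (e_adj isoC) //; apply/eqP/h1; rewrite lt7.
  have [_ vg] := far _ (gC i i7); rewrite e_sym.
  case: jE => ->; rewrite [X in e X _]/g /=.
  - by rewrite (negPf vg) (negPf h3).
  - by rewrite /g i7 ea h2.
  - by rewrite /g i7 eb h4.
have gW i : i \in verts 10 -> g i \in W.
  by move=> /split10[/gC h|[]->]; rewrite WE /g /= !inE ?eqxx ?orbT // h !orbT.
have notgC i : i \in verts 10 -> ~~ (i < 7) -> g i \notin C.
  by move=> /split10[->//|[]->].
have ginj : {in verts 10 &, injective g}.
  move=> i j hi hj gij; have [i7|] := boolP (i < 7); have [j7|] := boolP (j < 7).
  - have := rot i; rewrite lt7 i7 => /(_ isT)/and5P[_ _ _ _ /allP/(_ j)].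
    rewrite lt7 j7 => /(_ isT)/implyP h; apply/eqP/h/eqP/(f_inj isoC (hm i) (hm j)).
    by move: gij; rewrite /g i7 j7.
  - by move=> /(notgC j hj); rewrite -gij gC.
  - by move=> /(notgC i hi); rewrite gij gC.
  move: gij (split10 i hi) (split10 j hj) => + [->//|iE] [->//|jE].
  case: iE jE => -> [] -> //=; rewrite /g /= => /eqP;
    by rewrite ?(negPf nva, negPf nvb, negPf nab) // eq_sym ?(negPf nva, negPf nvb, negPf nab).
exists g; split=> //.
  (* Ten distinct vertices of [W] are hit, and [W] has at most [1 + 1 + 1 + 7] of them. *)
  apply/esym/eqP; rewrite eqEcard; apply/andP; split.
    by apply/subsetP => x; rewrite in_set => /mapP[i hi ->]; apply: gW.
  rewrite cardsE (card_uniqP _) ?map_inj_in_uniq ?iota_uniq // size_map size_iota.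
  by rewrite WE !cardsU1 (card_exc isoC) -[10]/(1 + (1 + (1 + 7))) !leq_add // leq_b1.
move=> i j hi hj; have [i7|iE] := split10 i hi; first exact: adj_lt.
have [j7|jE] := split10 j hj; first by rewrite e_sym adjC // adj_lt.
by case: iE jE => -> [] ->; rewrite /g /= ?e_irr ?va ?vb ?(negPf ab) // e_sym ?va ?vb ?(negPf ab).
Qed.

(* C is an exceptional component of W minus N[v], in a connected W without simplicial vertices.
   A neighbour of v is removable if an independent set far from v and C can dominate it. *)
Section Extension.
Variables (W : {set T}) (k : nat) (v : T) (C : {set T}) (n : nat) (f : nat -> T).
Hypotheses (wc : wck W k) (ns : {in W, forall s, ~~ simplicialb W s}) (vW : v \in W).
Hypothesis conn : forall D, closed_in W D -> D != set0 -> D = W.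
Hypotheses (clC : closed_in (W :\: cnbhs [set v]) C) (isoC : iso_exc n C f).
Hypothesis IH : forall (V : {set T}) j, V \subset W -> #|V| < #|W| -> wck V j ->
  forall x, x \in V -> structured V x.

Lemma core_sub : C \subset W.
Proof. by have /closed_inP[h _] := clC; apply: subset_trans h (subsetDl _ _). Qed.

Lemma core_far x : x \in C -> x != v /\ ~~ e v x.
Proof.
have /closed_inP[/subsetP h _] := clC.
by move=> /h; rewrite in_setD cnbhs1 negb_or => /andP[/andP[]].
Qed.

Lemma core_edge x y : x \in C -> y \in W -> e x y -> y \notin C -> e v y.
Proof.
move=> xC yW xy yC; have /closed_inP[_ h] := clC; apply: contraNT yC => vy.
apply: (h x) => //; rewrite in_setD yW andbT cnbhs1 negb_or vy andbT.
by apply: contraTneq xy => ->; have [_] := core_far xC; rewrite e_sym.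
Qed.

Lemma v_core : v \notin C.
Proof. by apply/negP => /core_far[]; rewrite eqxx. Qed.

Lemma core_neq0 : C != set0.
Proof.
rewrite -card_gt0 (card_exc isoC); case: isoC => + _ _ _.
by rewrite /order_exc !inE => /orP[]/eqP->.
Qed.

Lemma attached_exists : exists a c, [/\ a \in W, e v a, c \in C & e a c].
Proof.
have [/exists_inP[a aW /exists_inP[c cC /andP[va ac]]]|/exists_inPn h] :=
  boolP [exists a in W, exists c in C, e v a && e a c]; first by exists a, c.
have CE : C = W.
  apply: conn core_neq0; apply/closed_inP; split; first exact: core_sub.
  move=> x y xC yW xy; apply: contraT => yC.
  have vy := core_edge xC yW xy yC.
  by have /exists_inPn/(_ x xC) := h y yW; rewrite vy e_sym xy.
by case/negP: v_core; rewrite CE.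
Qed.

Definition removable (d : T) : bool :=
  [exists w in W, [&& e d w, w != v, ~~ e v w & w \notin C]].

Lemma unremovable_edge b y : ~~ removable b -> y \in W -> e b y -> y != v -> y \notin C -> e v y.
Proof.
move=> /exists_inPn h yW by_ nyv yC; have := h y yW.
by rewrite by_ nyv yC andbT negbK.
Qed.

Lemma unremovable_attached b : b \in W -> e v b -> ~~ removable b ->
  exists2 c, c \in C & e b c.
Proof.
move=> bW vb rb; have [w [wW bw nwv vw]] := outer_neighbor ns bW vb.
exists w => //; apply: contraNT vw => wC; exact: unremovable_edge bw nwv wC.
Qed.

(** Choose for each [d] in [R] a witness [w d] of removability. Two adjacent witnesses would close a
    5-cycle through [v], so they form an independent set [J]. Removing [N[J]] spares [v] and [C],
    and by the absence of 4-cycles it takes exactly [R] from the neighbours of [v]. *)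
Lemma remove_neighbors (R : {set T}) : {in R, forall d, [/\ d \in W, e v d & removable d]} ->
  exists (V : {set T}) j, [/\ V \subset W, wck V j, v \in V, C \subset V &
   (forall b, b \in W -> e v b -> (b \in V) = (b \notin R))] /\ (R != set0 -> #|V| < #|W|).
Proof.
move=> hR.
pose w d := odflt d [pick w in W | [&& e d w, w != v, ~~ e v w & w \notin C]].
have wP d : d \in R -> [/\ w d \in W, e d (w d), w d != v, ~~ e v (w d) & w d \notin C].
  move=> /hR[_ _ /exists_inP[u uW hu]]; rewrite /w; case: pickP => [u'|/(_ u)].
    by case/and5P.
  by rewrite uW hu.
pose J := w @: R; exists (W :\: cnbhs J), (k - #|J|).
have JW : J \subset W by apply/subsetP => _ /imsetP[d /wP[? _ _ _ _] ->].
have iJ : independent e J.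
  apply/indepP => _ _ /imsetP[d dR ->] /imsetP[d' dR' ->]; apply/negP => ww.
  have [_ dw nwv vw _] := wP d dR; have [_ dw' nwv' vw' _] := wP d' dR'.
  have [_ vd _] := hR d dR; have [_ vd' _] := hR d' dR'.
  have ndd : d != d' by apply: contraTneq ww => ->; rewrite e_irr.
  have ndw : d != w d' by apply: contraNneq vw' => <-.
  have ndw' : w d != d' by apply: contraNneq vw => ->.
  by c5 v d (w d) (w d') d'.
have inV x : x \in W -> (forall d, d \in R -> x != w d /\ ~~ e (w d) x) -> x \in W :\: cnbhs J.
  move=> xW hx; rewrite in_setD xW andbT inE negb_or; apply/andP; split.
    by apply/imsetP => -[d dR xE]; have [] := hx d dR; rewrite xE eqxx.
  by apply/exists_inPn => _ /imsetP[d dR ->]; have [] := hx d dR.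
have RV d : d \in R -> d \notin W :\: cnbhs J.
  move=> dR; rewrite in_setD negb_and negbK inE; apply/orP; left; apply/orP; right.
  by apply/exists_inP; exists (w d); rewrite ?imset_f //; have [_ ? _ _ _] := wP d dR; edge.
split; [split|].
- exact: subsetDl.
- exact: wck_remove.
- by apply: inV => // d /wP[_ _ nwv vw _]; rewrite eq_sym nwv e_sym vw.
- apply/subsetP => x xC; apply: inV; first exact: (subsetP core_sub).
  move=> d /wP[wW _ nwv vw wC]; split; first by apply: contraNneq wC => <-.
  by apply: contra vw; rewrite e_sym => xw; apply: (core_edge xC).
- move=> b bW vb; have [bR|bR] := boolP (b \in R); first exact/negbTE/RV.
  apply: inV => // d dR; have [wW dw nwv vw wC] := wP d dR; have [_ vd _] := hR d dR.
  split; first by apply: contraNneq vw => <-.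
  have ndb : d != b by apply: contraNneq bR => <-.
  by apply/negP => wb; c4 v d (w d) b.
case/set0Pn => d dR; apply: proper_card; apply/properP; split; first exact: subsetDl.
by exists d; [have [] := hR d dR|apply: RV].
Qed.

(** In the smaller [V] the vertex [c] lies in no simplex: no vertex of [C] is simplicial, and a
    simplicial vertex outside [C] would force [v] and [c] to be adjacent. So [c] is in an
    exceptional component, which contains [C], [b], [v] and a second neighbour of [v]; these are at
    least [n + 3] vertices, which leaves only 7 and 10 as orders. *)
Lemma enlarged_core (V : {set T}) j b c : V \subset W -> wck V j -> #|V| < #|W| ->
  v \in V -> C \subset V -> b \in V -> e v b -> c \in C -> e b c ->
  exists K g b', [/\ closed_in V K, iso_exc 10 K g, C \subset K, v \in K & b \in K] /\
    [/\ b' \in K, b' != b, e v b' &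
     forall x, x \in K -> [\/ x \in C, x = v, x = b | x = b']].
Proof.
move=> VW wcV ltV vV CV bV vb cC bc; have cV := subsetP CV c cC.
have [ncv vc] := core_far cC.
have [[p sp]|[K [m [g [clK cK isoK]]]]] := IH VW ltV wcV cV.
  have [pV cl] := sp; have pW := subsetP VW p pV; rewrite cnbhs1 => pc; exfalso.
  have [pC|pC] := boolP (p \in C).
    have [y [z [yC zC py [pz nyz yz]]]] := exc_nonsimplicial isoC pC.
    by case/negP: yz; apply: cl; rewrite ?(subsetP CV).
  have {}pc : e c p by case/orP: pc => [/eqP cp|]; [rewrite -cp cC in pC|edge].
  have vp := core_edge cC pW pc pC.
  by case/negP: vc; apply: cl; rewrite // 1?eq_sym // e_sym.
have /closed_inP[KV hK] := clK.
have CK : C \subset K.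
  by apply: (exc_conn isoC cK cC) => y z yK yC zC; apply: hK => //; apply: (subsetP CV).
have bK : b \in K by apply: (hK c); rewrite // e_sym.
have vK : v \in K by apply: (hK b); rewrite // e_sym.
have [b' [bK' nbb vb']] : exists b', [/\ b' \in K, b' != b & e v b'].
  have [y [z [yK zK vy [vz nyz _]]]] := exc_nonsimplicial isoK vK.
  have [yb|] := eqVneq y b; last by exists y.
  by exists z; split=> //; rewrite -yb eq_sym.
have notC x : e v x -> x \notin C by move=> vx; apply/negP => /core_far[_]; rewrite vx.
have UK : v |: (b |: (b' |: C)) \subset K by rewrite !subUset !sub1set vK bK bK' CK.
have cU : #|v |: (b |: (b' |: C))| = n.+3.
  rewrite !cardsU1 !inE (negPf v_core) !(negPf (notC _ _)) // (card_exc isoC).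
  by rewrite [b == b']eq_sym (negPf nbb) !(negPf (adj_neq _)).
have := subset_leq_card UK; rewrite cU (card_exc isoK) => ltnm.
have m10 : m = 10.
  case: isoK isoC => + _ _ _ [+ _ _ _]; rewrite /order_exc !inE.
  by case/orP=> /eqP mE; case/orP=> /eqP nE; move: ltnm; rewrite ?mE ?nE.
have n7 : n = 7.
  case: isoC => + _ _ _; rewrite /order_exc !inE.
  by case/orP=> /eqP nE //; move: ltnm; rewrite m10 nE.
rewrite m10 in isoK; exists K, g, b'; split; split=> //.
have -> : K = v |: (b |: (b' |: C)).
  by apply/esym/eqP; rewrite eqEcard UK cU (card_exc isoK) n7.
move=> x; rewrite !inE.
by case/or4P => [/eqP->|/eqP->|/eqP->|]; [apply: Or42|apply: Or43|apply: Or44|apply: Or41].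
Qed.

(** If some neighbour of [v] is not removable, deleting all removable ones leaves a component [K]
    with [v] in it; deleting all but [d] leaves [K] attached through [d] alone, against
    [single_attachment]. If all are removable, keep just one that is attached to [C]: then the
    second neighbour of [v] promised by [enlarged_core] is missing. *)
Lemma no_removable d : d \in W -> e v d -> removable d -> False.
Proof.
move=> dW vd rd; pose Rm := [set d in W | e v d && removable d].
have RmP x : x \in Rm -> [/\ x \in W, e v x & removable x] by rewrite inE => /and3P.
have nC x : e v x -> x \notin C by move=> vx; apply/negP => /core_far[_]; rewrite vx.
have [/exists_inP[b bW /andP[vb rb]]|/exists_inPn allR] :=
    boolP [exists b in W, e v b && ~~ removable b].
  have [c cC bc] := unremovable_attached bW vb rb.
  have [V [j [[VW wcV vV CV VN] ltV]]] := remove_neighbors RmP.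
  have {}ltV : #|V| < #|W| by apply: ltV; apply/set0Pn; exists d; rewrite inE dW vd.
  have bV : b \in V by rewrite VN // inE (negPf rb) !andbF.
  have [K [g [b' [[clK isoK CK vK bK] [bK' nbb vb' KE]]]]] :=
    enlarged_core VW wcV ltV vV CV bV vb cC bc.
  have /closed_inP[KV hK] := clK.
  have rK x : x \in K -> e v x -> ~~ removable x.
    move=> xK vx; have xV := subsetP KV x xK; have xW := subsetP VW x xV.
    by move: xV; rewrite VN // inE xW vx.
  have [|V' [j' [[VW' wcV' vV' CV' VN'] _]]] := @remove_neighbors (Rm :\ d).
    by move=> x /setD1P[_]; apply: RmP.
  have KV' : K \subset V'.
    apply/subsetP => x xK; have xW := subsetP VW x (subsetP KV x xK).
    have inV y : y \in W -> y \in K -> e v y -> y \in V'.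
      by move=> yW yK vy; rewrite VN' // !inE (negPf (rK y yK vy)) !andbF.
    by case: (KE x xK) => [/(subsetP CV')//|->//|xE|xE]; apply: inV; rewrite // xE.
  have dV' : d \in V' by rewrite VN' // !inE eqxx.
  have dK : d \notin K by apply/negP => /rK/(_ vd); rewrite rd.
  have : ~~ e d v; last by rewrite e_sym vd.
  apply: (single_attachment wcV' isoK KV' dV' dK _ vK) => x y xK yV' yK xy.
  have yW := subsetP VW' y yV'.
  have yC : y \notin C by apply: contra yK; apply: (subsetP CK).
  have vy : e v y.
    have nyv : y != v by apply: contraNneq yK => ->.
    have [xC|xE|xE|xE] := KE x xK.
    - exact: core_edge xC yW xy yC.
    - by rewrite -xE.
    - by apply: (unremovable_edge rb) => //; rewrite -xE.
    - by apply: (unremovable_edge (rK _ bK' vb')) => //; rewrite -xE.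
  apply/eqP; apply: contraT => nyd; move: yV'; rewrite VN' // !inE nyd yW vy /= => ry.
  by case/negP: yK; apply: (hK v) => //; rewrite VN // inE yW vy.
have {}allR x : x \in W -> e v x -> removable x.
  by move=> xW vx; have := allR x xW; rewrite vx negbK.
have [a [c [aW va cC ac]]] := attached_exists.
have [|V [j [[VW wcV vV CV VN] ltV]]] := @remove_neighbors (Rm :\ a).
  by move=> x /setD1P[_]; apply: RmP.
have aV : a \in V by rewrite VN // !inE eqxx.
have {}ltV : #|V| < #|W|.
  apply: ltV; have [x [y [xW yW vx [vy nxy _]]]] := not_simplicial vW (ns vW).
  apply/set0Pn; have [xa|nxa] := eqVneq x a.
    by exists y; rewrite !inE yW vy allR // -xa eq_sym nxy.
  by exists x; rewrite !inE xW vx allR // nxa.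
have [K [g [b' [[clK _ _ _ _] [bK' nba vb' _]]]]] := enlarged_core VW wcV ltV vV CV aV va cC ac.
have /closed_inP[KV _] := clK.
have bV' := subsetP KV b' bK'; have bW' := subsetP VW b' bV'.
by move: bV'; rewrite VN // !inE nba bW' vb' allR.
Qed.

(** * The case where W consists of N[v] and C: the graph T10 *)

Section NoRemovable.
Hypothesis nr : forall d, d \in W -> e v d -> ~~ removable d.

Let ck : checks n. Proof. by case: isoC => /checks_exc. Qed.
Let att d := idx n f (e d).

(** No edge leaves the union of [N[v]] and [C], so by connectedness it is all of [W]. *)
Lemma W_cases y : y \in W -> [\/ y = v, e v y | y \in C].
Proof.
have clB : closed_in W (W :&: (cnbhs [set v] :|: C)).
  apply/closed_inP; split; first exact: subsetIl.
  move=> x z /setIP[xW xB] zW xz; rewrite in_setI zW in_setU cnbhs1.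
  have [->|nzv /=] := eqVneq z v; first by [].
  have [//|zC] := boolP (z \in C); first by rewrite orbT.
  rewrite orbF; move: xB; rewrite in_setU cnbhs1 => /orP[/orP[/eqP <- //|vx]|xC].
    exact: (unremovable_edge (nr xW vx) zW xz).
  exact: core_edge xC zW xz zC.
have WE : W :&: (cnbhs [set v] :|: C) = W.
  by apply: conn => //; apply/set0Pn; exists v; rewrite in_setI vW in_setU cnbhs1 eqxx.
rewrite -WE in_setI in_setU cnbhs1 => /andP[_ /orP[/orP[/eqP|]|]].
- by apply: Or31.
- by apply: Or32.
- by apply: Or33.
Qed.

Lemma nbr_notC d : e v d -> d \notin C.
Proof. by move=> vd; apply/negP => /core_far[_]; rewrite vd. Qed.

Lemma att_safe d : d \in W -> e v d -> att d \in safes n.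
Proof.
move=> dW vd; have [c cC dc] := unremovable_attached dW vd (nr dW vd).
exact: (safe_att isoC (nbr_notC vd) cC dc).
Qed.

Lemma attP d i : (i \in att d) = e d (f i) && (i \in verts n).
Proof. by rewrite mem_filter. Qed.

(** A common neighbour in [C] would close a 4-cycle through [v], an edge between the attachments a
    5-cycle. *)
Lemma att_sep a b : e v a -> e v b -> a != b -> lsep (att a) (att b).
Proof.
move=> va vb nab; apply/allP => i; rewrite attP => /andP[ai hi].
have [niv vi] := core_far (memC isoC hi).
have nbi : b != f i by apply: contraNneq vi => <-.
have nib : f i != b by rewrite eq_sym.
apply/andP; split; first by rewrite attP hi andbT; apply/negP => bi; c4 v a (f i) b.
apply/hasPn => j; rewrite attP => /andP[bj hj]; rewrite -(e_adj isoC) //.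
have [njv vj] := core_far (memC isoC hj).
have naj : a != f j by apply: contraNneq vj => <-.
by apply/negP => ij; c5 v a (f i) (f j) b.
Qed.

(** A path of length two between the attachments would close a 5-cycle with the edge from [a] to
    [b]. *)
Lemma att_far a b : e v a -> e v b -> e a b -> lfar n (att a) (att b).
Proof.
move=> va vb ab; have nab := adj_neq ab; have /allP sep := att_sep va vb nab.
apply/allP => i ia; have := ia; rewrite attP => /andP[ai hi].
apply/allP => j jb; have := jb; rewrite attP => /andP[bj hj].
apply/hasPn => m hm; rewrite -!(e_adj isoC) //.
have neqC x l : e v x -> l \in verts n -> x != f l.
  by move=> vx hl; have [_ vl] := core_far (memC isoC hl); apply: contraNneq vl => <-.
have nij : f i != f j.
  apply/negP => /eqP /(f_inj isoC hi hj) ij; case/andP: (sep i ia).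
  by rewrite ij jb.
have nam := neqC a m va hm; have naj := neqC a j va hj.
have nib := neqC b i vb hi; have nmb := neqC b m vb hm.
by apply/negP => /andP[im mj]; c5 a (f i) (f m) (f j) b.
Qed.

Lemma short_img S : S \in linds n ->
  [/\ {subset S <= verts n}, uniq S, img f S \subset C & independent e (img f S)].
Proof.
rewrite mem_filter => /andP[iS /sublist_sub[hS uS]]; split=> //.
  exact: img_sub isoC _ hS.
exact: indep_img isoC _ hS iS.
Qed.

Lemma meets_img S d : {subset S <= verts n} ->
  reflect (exists2 s, s \in img f S & e d s) (meets S (att d)).
Proof.
move=> hS; apply: (iffP hasP) => [[i iS]|[s]].
  by rewrite attP => /andP[di hi]; exists (f i); rewrite // (mem_img isoC).
rewrite inE => /mapP[i iS ->] di; exists i => //.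
by rewrite attP di hS.
Qed.

Lemma core_mis S : S \in lmis n -> mis W (v |: img f S).
Proof.
rewrite mem_filter => /andP[dS Sl]; have [hS uS SC iS] := short_img Sl.
split.
- by rewrite subUset sub1set vW (subset_trans SC core_sub).
- by apply: indepU1 => // x /(subsetP SC)/core_far[].
- move=> w wW; rewrite in_setU1 negb_or => /andP[nwv wS].
  have [wv|vw|wC] := W_cases wW; first by rewrite wv eqxx in nwv.
    by exists v; rewrite ?setU11 // e_sym.
  have [i hi wE] := excP isoC wC; rewrite wE in wS *.
  have [s sS is_] := dom_img isoC hS hi dS hi wS.
  by exists s; rewrite // in_setU1 sS orbT.
Qed.

Lemma extension_order : k = (alpha n).+1.
Proof.
have [S Sm sS] : exists2 S, S \in lmis n & size S = alpha n.
  by case/and5P: ck => _ _ _ _ /and3P[_ _ /hasP[S Sm /eqP sS]]; exists S.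
have := Sm; rewrite mem_filter => /andP[_ Sl]; have [hS uS SC iS] := short_img Sl.
rewrite -(wc (core_mis Sm)) cardsU1 (contra (subsetP SC v) v_core).
by rewrite (card_img isoC) // sS.
Qed.

Lemma att_hitting a b : a \in W -> b \in W -> e v a -> e v b -> a != b -> ~~ e a b ->
  hitting (lmis n) (att a) (att b).
Proof.
move=> aW bW va vb nab ab; apply/allP => S Sm; apply: contraT; rewrite negb_or => /andP[Sa Sb].
have := Sm; rewrite mem_filter => /andP[_ Sl]; have [hS uS SC iS] := short_img Sl.
have far d : e v d -> ~~ meets S (att d) -> {in img f S, forall s, ~~ e d s}.
  by move=> vd Sd s sS; apply: contra Sd => ds; apply/(meets_img d hS); exists s.
have notS d : e v d -> d \notin img f S.
  by move=> /nbr_notC; apply: contra; apply: (subsetP SC).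
have := @wck_bound W (a |: (b |: img f S)) k wc.
rewrite -(wc (core_mis Sm)) !cardsU1 in_setU1 (negPf nab) (negPf (notS a va)) (notS b vb).
rewrite (contra (subsetP SC v) v_core) !add1n ltnn => h; suff: false by []; apply: h.
  by rewrite !subUset !sub1set aW bW (subset_trans SC core_sub).
apply: indepU1 => [|s]; first by apply: indepU1 (far b vb Sb).
by rewrite in_setU1 => /orP[/eqP->//|]; apply: far.
Qed.

(** Under [dom] the set [S] together with [a] is maximal independent in [W], but it has one vertex
    less than [v] together with a maximal independent set of [C]. *)
Lemma no_short_mis a S : a \in W -> e v a -> S \in linds n -> short n (att a) S ->
  (forall d, d \in W -> e v d -> d != a -> e a d || meets S (att d)) -> False.
Proof.
move=> aW va Sl /and3P[Sa dS /eqP sS] dom; have [hS uS SC iS] := short_img Sl.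
have aS : a \notin img f S by apply: contra (nbr_notC va); apply: (subsetP SC).
have misM : mis W (a |: img f S).
  split.
  - by rewrite subUset sub1set aW (subset_trans SC core_sub).
  - by apply: indepU1 => // s sS'; apply: contra Sa => as_; apply/(meets_img a hS); exists s.
  - move=> w wW; rewrite in_setU1 negb_or => /andP[nwa wS].
    have [->|vw|wC] := W_cases wW; first by exists a; rewrite ?setU11.
      case/orP: (dom w wW vw nwa) => [aw|/(meets_img w hS)[s sS' ws]].
        by exists a; rewrite ?setU11 // e_sym.
      by exists s; rewrite // in_setU1 sS' orbT.
    have [aw|aw] := boolP (e a w); first by exists a; rewrite ?setU11 // e_sym.
    have [i hi wE] := excP isoC wC; rewrite wE in wS aw *.
    have [|s sS' ws] := dom_img isoC hS hi dS _ wS.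
      by rewrite mem_filter hi andbT attP negb_and aw.
    by exists s; rewrite // in_setU1 sS' orbT.
have := wc misM; rewrite cardsU1 aS (card_img isoC) // sS extension_order add1n alphaK.
by move/eqP; rewrite eqn_leq ltnn andbF.
Qed.

Lemma unremovable_t10 : exists g, iso_exc 10 W g.
Proof.
have [a [b [aW bW va [vb nab ab]]]] := not_simplicial vW (ns vW).
have ba : ~~ e b a by rewrite e_sym.
have sA := att_safe aW va; have sB := att_safe bW vb.
have hAB := att_hitting aW bW va vb nab ab; have sep := att_sep va vb nab.
case/and5P: ck => _ _ _ _ /and3P[pairs triples _].
have := allP (allP pairs _ sA) _ sB; rewrite sep hAB /= => pairsAB.
have := allP (allP triples _ sA) _ sB; rewrite sep hAB /= => /allP triplesAB.
have [/exists_inP[d dW /and3P[vd nda ndb]]|/exists_inPn third] :=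
    boolP [exists d in W, [&& e v d, d != a & d != b]].
  have nad : a != d by rewrite eq_sym.
  have nbd : b != d by rewrite eq_sym.
  have hAD : e a d \/ hitting (lmis n) (att a) (att d).
    by have [|ad] := boolP (e a d); [left|right; apply: att_hitting].
  have hBD : e b d \/ hitting (lmis n) (att b) (att d).
    by have [|bd] := boolP (e b d); [left|right; apply: att_hitting].
  have not2 : e a d -> e b d -> False by move=> ad bd; c4 v a d b.
  have := triplesAB _ (att_safe dW vd); rewrite !att_sep //=.
  have -> : hitting (lmis n) (att a) (att d) || lfar n (att a) (att d).
    by case: hAD => [ad|->//]; rewrite (att_far va vd ad) orbT.
  have -> : hitting (lmis n) (att b) (att d) || lfar n (att b) (att d).
    by case: hBD => [bd|->//]; rewrite (att_far vb vd bd) orbT.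
  have -> /= : hitting (lmis n) (att a) (att d) || hitting (lmis n) (att b) (att d).
    by case: hAD => [ad|->//]; case: hBD => [/(not2 ad)//|->]; rewrite orbT.
  move=> /andP[/andP[n7 /allP room] crit].
  (* A fourth neighbour of [v] is attached to [C] somewhere, and [noroom] leaves no vertex for
     that. *)
  have nbrs4 x : x \in W -> e v x -> [|| x == a, x == b | x == d].
    move=> xW vx; apply: contraT; rewrite !negb_or => /and3P[nxa nxb nxd].
    have := att_safe xW vx; rewrite mem_filter => /andP[/andP[+ _] _].
    case E : (att x) => [|p s] // _.
    have px : p \in att x by rewrite E mem_head.
    have hp : p \in verts n by move: px; rewrite attP => /andP[].
    have sep1 y : e v y -> x != y -> lsep [:: p] (att y).
      by move=> vy nxy; rewrite /lsep /= andbT; apply: (allP (att_sep vx vy nxy)).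
    by case/negP: (room p hp); rewrite !sep1.
  exfalso; move: pairsAB; rewrite (negPf n7) /=.
  move=> /andP[/hasP[S Sl /andP[SB Sa]] /hasP[R Rl /andP[RA Rb]]].
  (* At most one of the edges [a d], [b d] is present. An endpoint [a] or [b] of it needs a short
     set meeting only the other one's attachment; without such an edge the triple check supplies a
     short set meeting two attachments. *)
  case: hAD => [ad|hAD].
    apply: (no_short_mis aW va Sl Sa) => x xW vx nxa.
    by case/or3P: (nbrs4 x xW vx) nxa => /eqP->; rewrite ?eqxx // ?SB ?ad ?orbT.
  case: hBD => [bd|hBD].
    apply: (no_short_mis bW vb Rl Rb) => x xW vx nxb.
    by case/or3P: (nbrs4 x xW vx) nxb => /eqP->; rewrite ?eqxx // ?RA ?bd ?orbT.
  move: crit; rewrite hAD hBD /=.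
  case/or3P => /hasP[Q Ql /and3P[Q1 Q2 Qs]].
  - apply: (no_short_mis aW va Ql Qs) => x xW vx nx.
    by case/or3P: (nbrs4 x xW vx) nx => /eqP->; rewrite ?eqxx // ?Q1 ?Q2 ?orbT.
  - apply: (no_short_mis bW vb Ql Qs) => x xW vx nx.
    by case/or3P: (nbrs4 x xW vx) nx => /eqP->; rewrite ?eqxx // ?Q1 ?Q2 ?orbT.
  - apply: (no_short_mis dW vd Ql Qs) => x xW vx nx.
    by case/or3P: (nbrs4 x xW vx) nx => /eqP->; rewrite ?eqxx // ?Q1 ?Q2 ?orbT.
have nbrs2 x : x \in W -> e v x -> (x == a) || (x == b).
  by move=> xW vx; have := third x xW; rewrite vx /= -negb_or negbK.
have WE : W = v |: (a |: (b |: C)).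
  apply/setP => x; rewrite !in_setU1; apply/idP/idP => [xW|].
    have [->|vx|xC] := W_cases xW; rewrite ?eqxx //; last by rewrite xC !orbT.
    by case/orP: (nbrs2 x xW vx) => ->; rewrite ?orbT.
  by case/or4P => [/eqP->|/eqP->|/eqP->|/(subsetP core_sub)].
have farC : {in C, forall x, x != v /\ ~~ e v x} by move=> x; apply: core_far.
(* With [a] and [b] the only neighbours of [v], a blocked pair yields a maximal independent set that
   is too small, so the T10 pattern remains. *)
case/orP: pairsAB => [/andP[/eqP n7 pat]|/andP[/hasP[S Sl /andP[SB Sa]] _]].
  have iso7 := isoC; rewrite n7 in iso7; move: pat; rewrite /att n7.
  have WE' : W = v |: (b |: (a |: C)) by rewrite WE; congr (_ |: _); rewrite setUCA.
  have nba : b != a by rewrite eq_sym.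
  case/orP=> pat; first exact: (t10_extension iso7 farC va vb nab ab WE pat).
  exact: (t10_extension iso7 farC vb va nba ba WE' pat).
exfalso; apply: (no_short_mis aW va Sl Sa) => x xW vx nxa.
by case/orP: (nbrs2 x xW vx) nxa => /eqP->; rewrite ?eqxx // SB orbT.
Qed.

End NoRemovable.

Lemma extension_t10 : exists g, iso_exc 10 W g.
Proof.
have [/exists_inP[d dW /andP[vd rd]]|/exists_inPn h] :=
  boolP [exists d in W, e v d && removable d]; first by case: (no_removable dW vd rd).
by apply: unremovable_t10 => d dW vd; have := h d dW; rewrite vd.
Qed.

End Extension.

(** * Structure of well-covered graphs without 4- and 5-cycles *)

Lemma well_covered_structured (W : {set T}) k : wck W k ->
  forall x, x \in W -> structured W x.
Proof.
have [m] := ubnP #|W|; elim: m W k => // m IHm W k leW wc.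
have IH (V : {set T}) j : V \subset W -> #|V| < #|W| -> wck V j ->
    forall x, x \in V -> structured V x.
  by move=> _ ltV; apply: IHm; apply: leq_trans ltV _; rewrite -ltnS.
have [/existsP[D /and3P[clD nD nDW]]|/existsPn noclosed] :=
    boolP [exists D : {set T}, [&& closed_in W D, D != set0 & D != W]].
  have /closed_inP[DW _] := clD.
  have lift E x : closed_in W E -> structured E x -> structured W x.
    move=> clE [[s ss xs]|[C [n [f [clC xC isoC]]]]].
      by left; exists s => //; apply: simplicial_closed ss.
    by right; exists C, n, f; split=> //; apply: closed_trans clC.
  have [k1 [k2 [wc1 wc2 _]]] := wck_closed wc clD.
  move=> x xW; have [xD|xD] := boolP (x \in D).
    apply: (lift D) => //; apply: (IH D k1) => //.
    by apply: proper_card; rewrite properEneq nDW.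
  apply: (lift (W :\: D)); first exact: closed_compl.
  by apply: (IH _ k2) => //; [apply: subsetDl|apply: card_setD_lt|rewrite inE xD].
(* The disconnected case is done; from here on the subgraph induced on [W] is connected. *)
have conn D : closed_in W D -> D != set0 -> D = W.
  by move=> clD nD; have := noclosed D; rewrite clD nD /= negbK => /eqP.
have IHv v : v \in W -> forall x, x \in W :\: cnbhs [set v] -> structured (W :\: cnbhs [set v]) x.
  move=> vW; apply: (IH _ (k - #|[set v]|)); first exact: subsetDl.
    apply: proper_card; apply/properP; split; first exact: subsetDl.
    by exists v; rewrite // in_setD cnbhs1 eqxx.
  by apply: wck_remove; rewrite ?sub1set ?indep1.
have [/exists_inP[s sW /simplicialP ss]|/exists_inPn ns] := boolP [exists s in W, simplicialb W s].
  by apply: (simplicial_step wc ss); apply: IHv.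
have [smpl|[v [C [n [f [vW [clC _ isoC]]]]]]] : (forall v, v \in W ->
      forall x, x \in W :\: cnbhs [set v] -> in_simplex (W :\: cnbhs [set v]) x) \/
    exists v C n f, v \in W /\
      [/\ closed_in (W :\: cnbhs [set v]) C, C != set0 & iso_exc n C f].
  apply: forall_or => v vW; have [h|[C [n [f h]]]] := structured_cases (IHv v vW).
    by left.
  by right; exists v, C, n, f.
- by move=> x xW; right; apply: (heptagon_component wc ns _ xW) => v s vW; apply: smpl.
have [g isoW] := extension_t10 wc ns vW conn clC isoC IH.
by move=> x xW; right; exists W, 10, g; split=> //; apply/closed_inP.
Qed.

End FourFive.

(** * Passage to the definitions by inclusion *)

Lemma mis_setT (S : {set T}) : maximal_independent e S <-> mis setT S.
Proof.
split=> [/maxsetP[iS maxS]|[_ iS domS]].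
  split=> // w _ wS; case: (boolP [exists s in S, e w s]) => [/exists_inP//|/exists_inPn h].
  by case/negP: wS; rewrite -(maxS (w |: S)) ?setU11 ?subsetUr //; apply: indepU1.
apply/maxsetP; split=> // R iR SR; apply/eqP; rewrite eqEsubset SR andbT.
apply/subsetP => w wR; apply: contraT => wS; have [s sS ws] := domS w (in_setT w) wS.
by case/negP: (indepP _ iR w s wR (subsetP SR s sS)).
Qed.

Lemma dominatingP (S : {set T}) :
  reflect (forall w, w \notin S -> exists2 s, s \in S & e w s) (dominating e S).
Proof.
apply: (iffP forallP) => h w.
  by move=> wS; have := h w; rewrite (negPf wS) => /exists_inP.
by have [//|/h/exists_inP] := boolP (w \in S).
Qed.

(** A vertex left undominated when [d] is dropped from [D] is a private neighbour of [d];
    conversely, any dominating subset of [D] must keep [d] to dominate that neighbour. *)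
Lemma mindom_setT (D : {set T}) : minimal_dominating e D <-> mindom setT D.
Proof.
split=> [/minsetP[/dominatingP domD minD]|[_ domD privD]].
  split=> [|w _|d dD]; [exact: subsetT|exact: domD|].
  have : ~~ dominating e (D :\ d).
    by apply/negP => /minD/(_ (subsetDl _ _)) DE; move: dD; rewrite -DE setD11.
  case/forallPn => w; rewrite negb_or => /andP[wD /exists_inPn nw].
  have wE : (w == d) || e w d.
    have [//|nwd /=] := eqVneq w d; have {}wD : w \notin D by rewrite in_setD1 nwd in wD.
    have [s sD ws] := domD w wD; have [<-//|nsd] := eqVneq s d.
    by have := nw s; rewrite in_setD1 nsd sD ws => /(_ isT).
  exists w; first exact: in_setT.
  split=> // d' dD' nd; split; last by apply: nw; rewrite in_setD1 nd.
  by apply: contraNneq wD => ->; rewrite in_setD1 nd.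
apply/minsetP; split; first by apply/dominatingP => w; apply: domD.
move=> R /dominatingP domR RD; apply/eqP; rewrite eqEsubset RD /=.
apply/subsetP => d dD; have [w _ [wd priv]] := privD d dD.
have only x : x \in R -> (x == w) || e w x -> x = d.
  move=> xR xw; apply/eqP; apply: contraT => nxd.
  have [nwx wx] := priv x (subsetP RD x xR) nxd.
  by move: xw; rewrite eq_sym (negPf nwx) (negPf wx).
have [wR|wR] := boolP (w \in R); first by rewrite -(only w wR) ?eqxx.
by have [s sR ws] := domR w wR; rewrite -(only s sR) ?ws ?orbT.
Qed.

End Graph.

Theorem mainTheorem1 (T : finType) (e : rel T) :
  simple_graph e -> connected_graph e -> ~ has_C4 e -> ~ has_C5 e ->
  (well_dominated e <-> well_covered e).
Proof.
move=> [e_sym e_irr] _ noC4 noC5; split=> wd S1 S2.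
  (* Maximal independent sets are minimal dominating sets, which settles this direction. *)
  have md S := iffLR (mis_setT e_sym e_irr S).
  by move=> /md/mis_mindom/mindom_setT h1 /md/mis_mindom/mindom_setT; apply: wd.
have [S misS] := mis_exists e_sym e_irr setT.
have wc : wck e setT #|S|.
  by move=> R /(mis_setT e_sym e_irr) misR; apply: wd => //; apply/(mis_setT e_sym e_irr).
have ST := well_covered_structured e_sym e_irr noC4 noC5.
move=> /mindom_setT m1 /mindom_setT m2.
by rewrite (structured_mindom e_sym e_irr ST wc m1) (structured_mindom e_sym e_irr ST wc m2).
Qed.
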